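(* Let $\overline{M}=I\times_f F$ be a Lorentzian warped product of dimension $n+1>5$ satisfying the Timelike Convergence Condition. Then there is no complete parabolic spacelike hypersurface $\psi:M\to\overline{M}$ of constant mean curvature $H\neq 0$ such that $$H^2\leq \frac{4}{n}\,\frac{f'(\tau)^2}{f(\tau)^2}\quad\text{on } M$$ and whose hyperbolic angle is bounded.
   Context: Let $n\ge 2$, let $(F,g_F)$ be a connected $n$-dimensional Riemannian manifold, $I\subset\mathbb{R}$ an open interval and $f:I\to(0,\infty)$ smooth. The Lorentzian warped product $\overline{M}=I\times_f F$ is $I\times F$ with the Lorentzian metric $\bar g=-\pi_I^*(dt^2)+f(\pi_I)^2\pi_F^*(g_F)$, where $\pi_I,\pi_F$ are the projections; $\partial_t=\partial/\partial t$ is the unit timelike coordinate vector field. $\overline{M}$ satisfies the Timelike Convergence Condition (TCC) if its Ricci tensor satisfies $\overline{\mathrm{Ric}}(z,z)\ge 0$ for every timelike vector $z$. A spacelike hypersurface is an immersion $\psi:M\to\overline{M}$ of an $n$-dimensional manifold $M$ whose induced metric $g_M$ is Riemannian; complete and parabolic refer to $(M,g_M)$. Put $\tau=\pi_I\circ\psi$, $f(\tau)=f\circ\tau$, $f'(\tau)=f'\circ\tau$. Let $N$ be the unique unit timelike normal vector field along $\psi$ with the same time-orientation as $-\partial_t$, i.e. $\bar g(N,\partial_t)>0$. The shape operator is $AX=-\overline{\nabla}_XN$ and the mean curvature is $H=-\frac1n\mathrm{trace}(A)$. The hyperbolic angle $\varphi\ge 0$ is defined by $\cosh\varphi=\bar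 g(N,\partial_t)$; it is bounded if $\sup_M\varphi<\infty$. A non-compact Riemannian manifold is parabolic if it admits no non-constant positive superharmonic function. *)

(* Defs.v *)
(* Smooth manifolds are given by an atlas on a topological space, and every
   tensor field by its components in the charts.  Tangent vectors are row
   vectors of components, so that the differential of a map acts by right
   multiplication by 'J f x, whose (i, j) entry is the i-th partial derivative
   of the j-th component of f. *)

From mathcomp Require Import all_boot all_order all_algebra.
From mathcomp Require Import all_classical all_reals all_analysis.

Set Implicit Arguments.
Unset Strict Implicit.
Unset Printing Implicit Defensive.

Import Order.TTheory GRing.Theory Num.Theory.
Import numFieldNormedType.Exports.

Local Open Scope classical_set_scope.
Local Open Scope ring_scope.

Definition partial (R : realType) m (i : 'I_m) (f : 'rV[R]_m -> R)
    (x : 'rV[R]_m) : R :=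
  'D_(delta_mx 0 i) f x.

(* For open U. *)
Fixpoint Ck (R : realType) m (k : nat) (U : set 'rV[R]_m)
    (f : 'rV[R]_m -> R) : Prop :=
  (forall x, U x -> {for x, continuous f}) /\
  (if k is l.+1 then
     forall i : 'I_m,
       (forall x, U x -> derivable f x (delta_mx 0 i)) /\ Ck l U (partial i f)
   else True).

Definition smooth_on (R : realType) m (U : set 'rV[R]_m)
    (f : 'rV[R]_m -> R) : Prop :=
  forall k, Ck k U f.

(* chart_inv a is the inverse of chart_map a : chart_dom a -> chart_img a; the
   values of both maps outside these sets are irrelevant. *)
Record atlas (R : realType) (T : topologicalType) (m : nat) := Atlas {
  chart_index : Type;
  chart_dom : chart_index -> set T;
  chart_map : chart_index -> T -> 'rV[R]_m;
  chart_inv : chart_index -> 'rV[R]_m -> T }.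

Definition chart_img (R : realType) (T : topologicalType) m (A : atlas R T m)
    (a : chart_index A) : set 'rV[R]_m :=
  chart_map a @` chart_dom a.

Definition local_rep (R : realType) (T S : topologicalType) m k
    (A : atlas R T m) (B : atlas R S k) (psi : T -> S)
    (a : chart_index A) (b : chart_index B) : 'rV[R]_m -> 'rV[R]_k :=
  chart_map b \o psi \o chart_inv a.

Definition local_dom (R : realType) (T S : topologicalType) m k
    (A : atlas R T m) (B : atlas R S k) (psi : T -> S)
    (a : chart_index A) (b : chart_index B) : set 'rV[R]_m :=
  chart_map a @` (chart_dom a `&` psi @^-1` chart_dom b).

(* For psi = id and A = B, local_rep a b is the transition map from the chart a
   to the chart b, defined on local_dom a b. *)
Record is_manifold (R : realType) (T : topologicalType) m (A : atlas R T m) :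
    Prop := {
  manifold_hausdorff : hausdorff_space T;
  manifold_second_countable : @second_countable T;
  manifold_cover : forall p : T, exists a : chart_index A, chart_dom a p;
  manifold_open_dom : forall a : chart_index A, open (chart_dom a);
  manifold_open_img : forall a : chart_index A, open (chart_img a);
  manifold_chartK : forall (a : chart_index A) p,
    chart_dom a p -> chart_inv a (chart_map a p) = p;
  manifold_chart_continuous : forall (a : chart_index A) p,
    chart_dom a p -> {for p, continuous (chart_map a)};
  manifold_inv_continuous : forall (a : chart_index A) x,
    chart_img a x -> {for x, continuous (chart_inv a)};
  manifold_transition : forall (a b : chart_index A) (j : 'I_m),
    smooth_on (local_dom id a b) (fun x => local_rep id a b x 0 j) }.

Definition metric_field (R : realType) (T : topologicalType) m
    (A : atlas R T m) : Type :=
  chart_index A -> 'rV[R]_m -> 'M[R]_m.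

Definition inner (R : realType) m (G : 'M[R]_m) (u v : 'rV[R]_m) : R :=
  (u *m G *m v^T) 0 0.

(* g = psi^* h *)
Definition is_pullback (R : realType) (T S : topologicalType) m k
    (A : atlas R T m) (B : atlas R S k) (psi : T -> S)
    (g : metric_field A) (h : metric_field B) : Prop :=
  forall (a : chart_index A) (b : chart_index B) x, local_dom psi a b x ->
    g a x = 'J (local_rep psi a b) x *m h b (local_rep psi a b x)
            *m ('J (local_rep psi a b) x)^T.

(* The field metric_tensor is the transformation law of a (0,2)-tensor. *)
Record is_riemannian (R : realType) (T : topologicalType) m (A : atlas R T m)
    (g : metric_field A) : Prop := {
  metric_tensor : is_pullback id g g;
  metric_smooth : forall (a : chart_index A) (i j : 'I_m),
    smooth_on (chart_img a) (fun x => g a x i j);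
  metric_sym : forall (a : chart_index A) x, chart_img a x ->
    (g a x)^T = g a x;
  metric_pos : forall (a : chart_index A) x v, chart_img a x ->
    v != 0 -> 0 < inner (g a x) v v }.

Record riemannianManifold (R : realType) (n : nat) := RiemannianManifold {
  rm_sort :> topologicalType;
  rm_atlas : atlas R rm_sort n;
  rm_metric : metric_field rm_atlas;
  rm_is_manifold : is_manifold rm_atlas;
  rm_is_riemannian : is_riemannian rm_metric }.

(* Levi-Civita connection: nabla_(d_i) d_j = \sum_k (christoffel G k i j) d_k *)
Definition christoffel (R : realType) m (G : 'rV[R]_m -> 'M[R]_m)
    (k i j : 'I_m) (x : 'rV[R]_m) : R :=
  2^-1 * \sum_(l < m) invmx (G x) k l *
    (partial i (fun y => G y j l) x + partial j (fun y => G y i l) x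
     - partial l (fun y => G y i j) x).

(* R(d_i, d_j) d_k = \sum_l (riemann G l k i j) d_l, with
   R(X, Y) = [nabla_X, nabla_Y] - nabla_[X, Y] *)
Definition riemann (R : realType) m (G : 'rV[R]_m -> 'M[R]_m)
    (l k i j : 'I_m) (x : 'rV[R]_m) : R :=
  partial i (christoffel G l j k) x - partial j (christoffel G l i k) x
  + \sum_(h < m) (christoffel G l i h x * christoffel G h j k x
                  - christoffel G l j h x * christoffel G h i k x).

(* Ric(Y, Z) is the trace of X |-> R(X, Y) Z, so that round spheres have
   positive Ricci curvature. *)
Definition ricci (R : realType) m (G : 'rV[R]_m -> 'M[R]_m)
    (x : 'rV[R]_m) : 'M[R]_m :=
  \matrix_(j < m, k < m) \sum_(i < m) riemann G i k i j x.

(* Trace of the Hessian *)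
Definition laplacian (R : realType) m (G : 'rV[R]_m -> 'M[R]_m)
    (u : 'rV[R]_m -> R) (x : 'rV[R]_m) : R :=
  \sum_(i < m) \sum_(j < m) invmx (G x) i j *
    (partial i (partial j u) x
     - \sum_(k < m) christoffel G k i j x * partial k u x).

Definition superharmonic (R : realType) n (M : riemannianManifold R n)
    (u : M -> R) : Prop :=
  forall a : chart_index (rm_atlas M),
    Ck 2 (chart_img a) (u \o chart_inv a) /\
    forall x, chart_img a x ->
      laplacian (rm_metric a) (u \o chart_inv a) x <= 0.

Definition parabolic (R : realType) n (M : riemannianManifold R n) : Prop :=
  ~ compact [set: M] /\
  forall u : M -> R, (forall p, 0 < u p) -> superharmonic u ->
    forall p q, u p = u q.

Definition curve_coord (R : realType) n (M : riemannianManifold R n)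
    (gamma : R -> M) (a : chart_index (rm_atlas M)) (k : 'I_n) : R -> R :=
  fun s => chart_map a (gamma s) 0 k.

Definition is_geodesic (R : realType) n (M : riemannianManifold R n)
    (gamma : R -> M) : Prop :=
  continuous gamma /\
  forall (a : chart_index (rm_atlas M)) (s : R) (k : 'I_n),
    chart_dom a (gamma s) ->
    [/\ derivable (curve_coord gamma a k) s 1,
        derivable (derive1 (curve_coord gamma a k)) s 1
      & derive1n 2 (curve_coord gamma a k) s
        + \sum_(i < n) \sum_(j < n)
            christoffel (rm_metric a) k i j (chart_map a (gamma s))
            * derive1 (curve_coord gamma a i) s
            * derive1 (curve_coord gamma a j) s
        = 0].

(* Every tangent vector is the initial velocity of a geodesic defined on R. *)
Definition complete (R : realType) n (M : riemannianManifold R n) : Prop :=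
  forall (p : M) (a : chart_index (rm_atlas M)) (v : 'rV[R]_n),
    chart_dom a p ->
    exists gamma : R -> M,
      [/\ is_geodesic gamma, gamma 0 = p
        & forall k, derive1 (curve_coord gamma a k) 0 = v 0 k].

Definition is_warping (R : realType) (I : set R) (f : R -> R) : Prop :=
  [/\ I !=set0, open I, is_interval I, forall t, I t -> 0 < f t
    & forall (k : nat) t, I t -> derivable (derive1n k f) t 1].

(* The product charts (t, y) of I x F, which is carried by an open subset of
   R * F: the charts cover exactly this subset. *)
Definition warped_atlas (R : realType) n (F : riemannianManifold R n)
    (I : set R) : atlas R (R * F)%type (1 + n) :=
  @Atlas R (R * F)%type (1 + n) (chart_index (rm_atlas F))
    (fun b => I `*` chart_dom b)
    (fun b z => row_mx z.1%:M (chart_map b z.2))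
    (fun b x => (lsubmx x 0 0, chart_inv b (rsubmx x))).

(* - dt^2 + f(t)^2 g_F *)
Definition warped_metric (R : realType) n (F : riemannianManifold R n)
    (I : set R) (f : R -> R) : metric_field (warped_atlas F I) :=
  fun b x => block_mx (- 1%:M) 0
               0 (f (lsubmx x 0 0) ^+ 2 *: rm_metric (r := F) b (rsubmx x)).

Definition dt_field (R : realType) n : 'rV[R]_(1 + n) := row_mx 1%:M 0.

Definition timelike_convergence (R : realType) n (F : riemannianManifold R n)
    (I : set R) (f : R -> R) : Prop :=
  forall (b : chart_index (warped_atlas F I)) x (z : 'rV[R]_(1 + n)),
    chart_img b x ->
    inner (warped_metric f b x) z z < 0 ->
    0 <= inner (ricci (warped_metric f b) x) z z.

Record is_immersion (R : realType) (T S : topologicalType) m k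
    (A : atlas R T m) (B : atlas R S k) (psi : T -> S) : Prop := {
  immersion_continuous : continuous psi;
  immersion_range : forall p, exists b : chart_index B, chart_dom b (psi p);
  immersion_smooth : forall (a : chart_index A) (b : chart_index B) (j : 'I_k),
    smooth_on (local_dom psi a b) (fun x => local_rep psi a b x 0 j);
  immersion_inj : forall (a : chart_index A) (b : chart_index B) x,
    local_dom psi a b x -> row_free ('J (local_rep psi a b) x) }.

(* V p b : components, in the chart b, of a vector tangent to S at psi p *)
Definition field_along (R : realType) (T S : topologicalType) k
    (B : atlas R S k) (psi : T -> S) : Type :=
  T -> chart_index B -> 'rV[R]_k.

Record is_field_along (R : realType) (T S : topologicalType) m k
    (A : atlas R T m) (B : atlas R S k) (psi : T -> S)
    (V : field_along B psi) : Prop := {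
  field_along_tensor : forall p (b c : chart_index B),
    chart_dom b (psi p) -> chart_dom c (psi p) ->
    V p c = V p b *m 'J (local_rep id b c) (chart_map b (psi p));
  field_along_smooth : forall (a : chart_index A) (b : chart_index B)
      (j : 'I_k),
    smooth_on (local_dom psi a b) (fun x => V (chart_inv a x) b 0 j) }.

(* The i-th row holds the components in the chart b of the covariant derivative
   of V, for the connection of h, along the i-th coordinate field of a. *)
Definition covariant_along (R : realType) (T S : topologicalType) m k
    (A : atlas R T m) (B : atlas R S k) (h : metric_field B) (psi : T -> S)
    (V : field_along B psi) (a : chart_index A) (b : chart_index B)
    (x : 'rV[R]_m) : 'M[R]_(m, k) :=
  \matrix_(i < m, j < k)
    (partial i (fun y => V (chart_inv a y) b 0 j) x
     + \sum_(p < k) \sum_(q < k)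
         christoffel (h b) j p q (local_rep psi a b x)
         * 'J (local_rep psi a b) x i p * V (chart_inv a x) b 0 q).

(* The metric of the source is the one induced by the immersion, hence the
   induced metric is Riemannian.  The normal N and the shape operator A are
   determined by hs_map; row i of hs_shape a x holds the components of the
   image under A of the i-th coordinate field of the chart a. *)
Record spacelikeHypersurface (R : realType) (n : nat)
    (F : riemannianManifold R n) (I : set R) (f : R -> R) :=
    SpacelikeHypersurface {
  hs_source :> riemannianManifold R n;
  hs_map : hs_source -> (R * F)%type;
  hs_normal : field_along (warped_atlas F I) hs_map;
  hs_shape : chart_index (rm_atlas hs_source) -> 'rV[R]_n -> 'M[R]_n;
  hs_immersion : is_immersion (rm_atlas hs_source) (warped_atlas F I) hs_map;
  hs_induced : is_pullback hs_map (@rm_metric R n hs_source)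
                 (warped_metric (I := I) f);
  hs_normal_field : is_field_along (rm_atlas hs_source) hs_normal;
  hs_normal_unit : forall p (b : chart_index (warped_atlas F I)),
    chart_dom b (hs_map p) ->
    inner (warped_metric f b (chart_map b (hs_map p)))
      (hs_normal p b) (hs_normal p b) = -1;
  hs_normal_orthogonal : forall (a : chart_index (rm_atlas hs_source))
      (b : chart_index (warped_atlas F I)) x (v : 'rV[R]_n),
    local_dom hs_map a b x ->
    inner (warped_metric f b (local_rep hs_map a b x))
      (hs_normal (chart_inv a x) b) (v *m 'J (local_rep hs_map a b) x) = 0;
  hs_normal_orientation : forall p (b : chart_index (warped_atlas F I)),
    chart_dom b (hs_map p) ->
    0 < inner (warped_metric f b (chart_map b (hs_map p)))
          (hs_normal p b) (dt_field R n);
  hs_shapeE : forall (a : chart_index (rm_atlas hs_source))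
      (b : chart_index (warped_atlas F I)) x,
    local_dom hs_map a b x ->
    hs_shape a x *m 'J (local_rep hs_map a b) x
    = - covariant_along (warped_metric f) hs_normal a b x }.

Definition tau (R : realType) n (F : riemannianManifold R n) (I : set R)
    (f : R -> R) (X : spacelikeHypersurface F I f) (p : X) : R :=
  (hs_map p).1.

Definition mean_curvature (R : realType) n (F : riemannianManifold R n)
    (I : set R) (f : R -> R) (X : spacelikeHypersurface F I f)
    (a : chart_index (rm_atlas X)) (x : 'rV[R]_n) : R :=
  - (n%:R^-1 * \tr (hs_shape a x)).

Definition constant_mean_curvature (R : realType) n
    (F : riemannianManifold R n) (I : set R) (f : R -> R)
    (X : spacelikeHypersurface F I f) (H : R) : Prop :=
  forall (a : chart_index (rm_atlas X)) x,
    chart_img a x -> mean_curvature a x = H.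

Definition cosh (R : realType) (x : R) : R := (expR x + expR (- x)) / 2.

Definition is_hyperbolic_angle (R : realType) n (F : riemannianManifold R n)
    (I : set R) (f : R -> R) (X : spacelikeHypersurface F I f)
    (phi : X -> R) : Prop :=
  forall p (b : chart_index (warped_atlas F I)), chart_dom b (hs_map p) ->
    0 <= phi p /\
    cosh (phi p) = inner (warped_metric f b (chart_map b (hs_map p)))
                     (hs_normal p b) (dt_field R n).

Definition bounded_hyperbolic_angle (R : realType) n
    (F : riemannianManifold R n) (I : set R) (f : R -> R)
    (X : spacelikeHypersurface F I f) : Prop :=
  exists phi : X -> R,
    is_hyperbolic_angle phi /\ exists C : R, forall p, phi p <= C.

(* Main.v *)
(* With u = cosh(phi) = <N, d_t>, Codazzi's equation for a hypersurface of constant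
   mean curvature and the formula nabla_Y d_t = (f'/f) (Y + <Y, d_t> d_t) give,
   for S = - A, c = f'/f and s^2 = |grad tau|^2 = u^2 - 1,
     Delta u = u tr(S^2) + 2 c <S grad tau, grad tau> + c n H (1 + u^2)
               + c^2 u (n + 3 s^2) - (f''/f) u s^2 + Ric(d_t, N) + u Ric(N, N).
   The convergence condition gives f'' <= 0 and makes the sum of the two Ricci
   terms nonnegative, and Cauchy-Schwarz for S + (c/u) grad tau (x) grad tau bounds
   the first two terms below.  What remains is a quadratic form in (H, c) which
   is positive when H^2 <= (4/n) c^2, c != 0 and n >= 5.  Hence Delta u > 0, and a
   constant minus the bounded function u is a positive non-constant superharmonic
   function, against parabolicity. *)

From HB Require Import structures.
Require Import Defs.
From mathcomp Require Import all_boot all_order all_algebra.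
From mathcomp Require Import all_classical all_reals all_analysis.
From mathcomp Require Import ring lra.

Set Implicit Arguments.
Unset Strict Implicit.
Unset Printing Implicit Defensive.

Import Order.TTheory GRing.Theory Num.Theory.
Import numFieldNormedType.Exports.

Local Open Scope classical_set_scope.
Local Open Scope ring_scope.

(** * Differentiability of functions of class C^1 and symmetry of second derivatives *)

(** The weight c/u in S + (c/u) grad tau (x) grad tau is the one for which u times the cross term of
    its square is exactly 2 c <S grad tau, grad tau>. That c never vanishes follows from the bound
    on H^2, because H is not zero. The dimension is what keeps the final quadratic form positive: at
    u = 1 and H = -2c / sqrt n it equals c^2 (sqrt n - 2)^2, which is zero for n = 4. Everything is
    computed in components, on the open set where a chart of M is mapped into one product chart. A
    vector field along the immersion is a function with values in row vectors, differentiated by the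
    pulled-back connection [cov]. One identity, the commutator of two such derivatives, yields
    Codazzi's equation, the antisymmetry of the curvature with respect to the metric and the
    curvature of the warped product in the direction of d_t. The Laplacian inequality is strict at
    every point, so non-constancy comes for free: a constant function would have zero Laplacian. *)

Lemma derivable_lineE (R : realType) (V : normedModType R) (f : V -> R)
    (y v : V) (t : R) :
  (fun h : R => h^-1 *: (((fun s : R => f (y + s *: v)) \o shift t) (h *: 1)
                     - f (y + t *: v)))
  = (fun h : R => h^-1 *: ((f \o shift (y + t *: v)) (h *: v)
                     - f (y + t *: v))).
Proof.
apply/funext => h /=; congr (_ *: (f _ - _)).
by rewrite [h *: 1]mulr1 scalerDl addrCA.
Qed.

Lemma derivable_line (R : realType) (V : normedModType R) (f : V -> R)
    (y v : V) (t : R) : derivable f (y + t *: v) v ->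
  is_derive t 1 (fun s : R => f (y + s *: v)) ('D_v f (y + t *: v)).
Proof.
move=> df; split; first by rewrite /derivable derivable_lineE.
by rewrite /derive derivable_lineE.
Qed.

(** The sign of [a] is left open because [a] will be a coordinate of an arbitrary increment; the
    proof works on [[0, a]] or on [[a, 0]]. *)
Lemma MVT_line (R : realType) (V : normedModType R) (f : V -> R)
    (y v : V) (a : R) :
  (forall t : R, `|t| <= `|a| -> derivable f (y + t *: v) v) ->
  exists2 c, `|c| <= `|a|
    & f (y + a *: v) - f y = a * 'D_v f (y + c *: v).
Proof.
move=> df.
have dg (t : R) : `|t| <= `|a| ->
    is_derive t 1 (fun s : R => f (y + s *: v)) ('D_v f (y + t *: v)).
  by move=> /df; exact: derivable_line.
have cg (A : set R) : (forall t, A t -> `|t| <= `|a|) ->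
    {within A, continuous (fun s : R => f (y + s *: v))}.
  move=> hA; apply: continuous_in_subspaceT => t /set_mem /hA /dg [dt _].
  by apply: differentiable_continuous; apply/derivable1_diffP.
have [a0|a0] := leP 0 a.
- have [t||c] := @MVT_segment R (fun s : R => f (y + s *: v))
    (fun s => 'D_v f (y + s *: v)) 0 a a0.
  + by rewrite in_itv /= => /andP[t0 ta]; apply: dg; rewrite !ger0_norm // ltW.
  + by apply: cg => t /=; rewrite in_itv /= => /andP[t0 ta]; rewrite !ger0_norm.
  + rewrite in_itv /= => /andP[t0 ta] E; exists c; first by rewrite !ger0_norm.
    by move: E; rewrite scale0r addr0 subr0 mulrC.
- have [t||c] := @MVT_segment R (fun s : R => f (y + s *: v))
    (fun s => 'D_v f (y + s *: v)) a 0 (ltW a0).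
  + rewrite in_itv /= => /andP[ta t0]; apply: dg.
    by rewrite !ler0_norm ?lerN2 // ltW.
  + apply: cg => t /=; rewrite in_itv /= => /andP[ta t0].
    by rewrite !ler0_norm ?lerN2 // ltW.
  + rewrite in_itv /= => /andP[ta t0] E; exists c.
      by rewrite !ler0_norm ?lerN2 // ltW.
    move: E; rewrite scale0r addr0 sub0r mulrN mulrC => E.
    by rewrite -opprB E opprK.
Qed.

Lemma norm_mx_le (R : realType) m n (A : 'M[R]_(m, n)) (e : R) :
  0 <= e -> (forall i j, `|A i j| <= e) -> `|A| <= e.
Proof.
move=> e0 H; rewrite /Num.Def.normr /= mx_normrE.
by apply: bigmax_le => // -[i j] _ /=.
Qed.

Lemma norm_coord_le (R : realType) m n (A : 'M[R]_(m, n)) i j :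
  `|A i j| <= `|A|.
Proof.
rewrite [leRHS]/Num.Def.normr /= mx_normrE.
exact: (le_bigmax _ (fun ij => `|A ij.1 ij.2|) (i, j)).
Qed.

(** [differentiable] refers to the canonical differential ['d f x]; uniqueness of the differential
    identifies it with any continuous linear map that gives a first-order expansion. *)
Lemma differentiable_of_littleo (R : realType) (V W : normedModType R)
    (f : V -> W) (df : {linear V -> W}) x :
  continuous df -> f \o shift x = cst (f x) + df +o_ 0 id ->
  differentiable f x.
Proof.
by move=> cdf E; apply/diff_locallyP; rewrite (diff_unique cdf E).
Qed.

Section C1_differentiable.
Variables (R : realType) (m : nat).
Implicit Types (U : set 'rV[R]_m) (f : 'rV[R]_m -> R) (x h : 'rV[R]_m).

(** Staircase from 0 to [h]: consecutive corners differ along a single coordinate axis, where the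
    mean value theorem applies. *)
Let trunc h k : 'rV[R]_m := \row_i (if (i < k)%N then h 0 i else 0).

Let truncS h (k : 'I_m) : trunc h k.+1 = trunc h k + h 0 k *: delta_mx 0 k.
Proof.
apply/rowP => i; rewrite !mxE eqxx /= ltnS leq_eqVlt.
have [->|ne] /= := eqVneq i k.
  by rewrite eqxx ltnn mulr1 add0r.
rewrite (_ : (i == k :> nat) = false) ?mulr0 ?addr0 //.
by apply/negbTE; rewrite -(inj_eq val_inj) in ne.
Qed.

Lemma C1_differentiable U f x : open U -> Ck 1 U f -> U x ->
  differentiable f x.
Proof.
move=> oU [cf dfU] Ux.
pose L (v : 'rV[R]_m) := \sum_(i < m) v 0 i * partial i f x.
have Llin : linear (L : 'rV[R]_m -> R).
  move=> a u v; rewrite /L scaler_sumr -big_split /=; apply: eq_bigr => i _.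
  by rewrite !mxE mulrDl -mulrA.
pose LLM := GRing.isLinear.Build _ _ _ _ _ Llin.
pose LL : {linear 'rV[R]_m -> R} := HB.pack L LLM.
apply: (@differentiable_of_littleo _ _ _ _ LL).
  have Lc : continuous L.
    apply: (@continuous_big R 'I_m +%R 0 xpredT _ 'rV[R]_m (index_enum 'I_m)
      (fun i (v : 'rV[R]_m) => v 0 i * partial i f x)); last move=> i _ v.
      exact: add_continuous.
    apply: differentiable_continuous; apply: differentiableM.
      exact: differentiable_coord.
    exact: differentiable_cst.
  exact: Lc.
apply/eqaddoP => _/posnumP[e].
(* The error [e] is shared evenly among the [m] steps of the staircase, so [m = 0] is set apart. *)
have [m0|m0] := posnP m.
  near=> h; rewrite /=.
  have -> : h = 0 by apply/rowP => -[i im]; exfalso; move: im; rewrite m0.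
  rewrite [X in `|X|](_ : _ = 0) ?normr0 ?mulr0 //.
  by rewrite !fctE /= add0r (_ : L 0 = 0) ?addr0 ?subrr //; exact: (linear0 LL).
have e'0 : 0 < e%:num / m%:R by rewrite divr_gt0 // ltr0n.
have : \forall y \near x, U y /\ forall i : 'I_m,
    `|partial i f x - partial i f y| <= e%:num / m%:R.
  apply: filterI; first exact: open_nbhs_nbhs.
  apply: (@filter_forall _ _ (fun (i : 'I_m) y =>
    `|partial i f x - partial i f y| <= e%:num / m%:R) (nbhs x) _) => i.
  have [_ [ci _]] := dfU i.
  have /cvgrPdist_le := ci x Ux.
  exact.
move=> /nbhs_ballP [d d0] xd.
near=> h.
have hd : `|h| < d.
  near: h; apply/nbhs_ballP; exists d => // h /=.
  by rewrite -ball_normE /ball_ /= sub0r normrN.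
(* Induction along the staircase: each step replaces a partial derivative at an intermediate point
   by its value at [x], at a cost of at most [e / m] times the norm of [h]. In the sup norm no
   intermediate point is farther from [x] than the norm of [h]. *)
have key k : (k <= m)%N ->
    `|f (x + trunc h k) - f x
      - \sum_(i < m | (i < k)%N) h 0 i * partial i f x|
    <= k%:R * (e%:num / m%:R * `|h|).
  elim: k => [_|k IH km].
    rewrite big1 // subr0 (_ : trunc h 0 = 0) ?addr0 ?subrr ?normr0 ?mul0r //.
    by apply/rowP => i; rewrite !mxE.
  pose k' := Ordinal km.
  have inball t : `|t| <= `|h 0 k'| ->
      ball x d (x + trunc h k + t *: delta_mx 0 k').
    move=> th; rewrite -ball_normE /ball_ /= -addrA opprD addNKr normrN.
    apply: le_lt_trans hd; apply: norm_mx_le => // i j.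
    rewrite !mxE (ord1 i) eqxx /=.
    have [->|ne] /= := eqVneq j k'.
      by rewrite ltnn mulr1 add0r (le_trans th) // norm_coord_le.
    rewrite mulr0 addr0; case: ifP => _; last by rewrite normr0.
    exact: norm_coord_le.
  have [t th|c ch E] := @MVT_line R _ f (x + trunc h k) (delta_mx 0 k') (h 0 k').
    have [dd _] := dfU k'; apply: dd.
    by have [] := xd _ (inball _ th).
  have [_ /(_ k')] := xd _ (inball _ ch).
  move: E; set y := _ + c *: _ => E yE.
  rewrite (truncS h k') addrA.
  rewrite (bigD1 k') //= ?ltnS //.
  rewrite (eq_bigl (fun i : 'I_m => (i < k)%N)); last first.
    move=> i; rewrite ltnS leq_eqVlt -(inj_eq val_inj) /=.
    by case: ltngtP.
  set S := \sum_(i < m | _) _ in IH *.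
  have -> : f (x + trunc h k + h 0 k' *: delta_mx 0 k') - f x
      - (h 0 k' * partial k' f x + S)
    = (f (x + trunc h k) - f x - S)
      + - (h 0 k' * (partial k' f x - partial k' f y)).
    move: E; rewrite -/(partial k' f y) => E.
    by rewrite mulrBr -E; ring.
  rewrite -(addn1 k) natrD mulrDl mul1r.
  apply: (le_trans (ler_normD _ _)); apply: lerD; first exact/IH/ltnW.
  rewrite normrN normrM mulrC; apply: ler_pM => //; exact: norm_coord_le.
have := key m (leqnn m).
rewrite mulrA (mulrC m%:R) divfK ?pnatr_eq0 -?lt0n //.
rewrite (_ : trunc h m = h); last by apply/rowP => i; rewrite !mxE ltn_ord.
rewrite (eq_bigl xpredT) => [|i]; last by rewrite ltn_ord.
by rewrite !fctE /= (addrC h x) opprD addrA.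
Unshelve. all: by end_near. Qed.

End C1_differentiable.

Lemma subrBB_swap (R : realType) (a b c d : R) :
  a - b - (c - d) = a - c - (b - d).
Proof. by lra. Qed.

Lemma ler_dist_half (R : realType) (a b c e : R) :
  `|a - c| <= e / 2 -> `|b - c| <= e / 2 -> `|a - b| <= e.
Proof.
move=> ac bc; rewrite -(subrKA c) (le_trans (ler_normD _ _)) //.
by rewrite (splitr e) lerD // distrC.
Qed.

(* At suitable points near x both mixed derivatives equal the same second
   difference of f divided by s^2. *)
Lemma partial_comm (R : realType) m (U : set 'rV[R]_m) f (i j : 'I_m) x :
  open U -> Ck 2 U f -> U x ->
  partial i (partial j f) x = partial j (partial i f) x.
Proof.
move=> oU [cf dfU] Ux.
have [dj [cj /(_ i) [dij [cij _]]]] := dfU j.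
have [di [ci /(_ j) [dji [cji _]]]] := dfU i.
apply/eqP; rewrite -subr_eq0 -normr_eq0 eq_le normr_ge0 andbT.
apply/ler_addgt0Pl => e e0; rewrite addr0.
have e20 : 0 < e / 2 by rewrite divr_gt0.
have : \forall y \near x, U y /\
   (`|partial i (partial j f) x - partial i (partial j f) y| <= e / 2 /\
    `|partial j (partial i f) x - partial j (partial i f) y| <= e / 2).
  apply: filterI; first exact: open_nbhs_nbhs.
  apply: filterI.
    by have /cvgrPdist_le := cij x Ux; apply.
  by have /cvgrPdist_le := cji x Ux; apply.
move=> /nbhs_ballP [d d0] xd.
pose s := d / 4.
have s0 : 0 < s by rewrite divr_gt0.
have inball (a b : 'I_m) t r : `|t| <= `|s| -> `|r| <= `|s| ->
    ball x d (x + t *: delta_mx 0 a + r *: delta_mx 0 b).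
  rewrite (gtr0_norm s0) => ts rs; rewrite -ball_normE /ball_ /=.
  rewrite -addrA opprD addNKr normrN.
  apply: (@le_lt_trans _ _ (s + s)); last by have d0' : 0 < d := d0; rewrite /s; lra.
  apply: norm_mx_le => [|k l]; first by rewrite addr_ge0 // ltW.
  rewrite !mxE; apply: (le_trans (ler_normD _ _)).
  by apply: lerD; case: (_ && _); rewrite ?mulr1 ?mulr0 ?normr0 // ltW.
(* The mean value theorem is used twice, for the first difference [g] in direction [a] and then for
   [partial a f] in direction [b]. The second difference on the left is symmetric in [a] and [b]. *)
have key (a b : 'I_m) : (forall x, U x -> derivable f x (delta_mx 0 a)) ->
   (forall x, U x -> derivable (partial a f) x (delta_mx 0 b)) ->
   exists2 y, ball x d y &
     f (x + s *: delta_mx 0 b + s *: delta_mx 0 a) - f (x + s *: delta_mx 0 a)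
     - (f (x + s *: delta_mx 0 b) - f x) = s * (s * partial b (partial a f) y).
  move=> da db.
  pose g z := f (z + s *: delta_mx 0 b) - f z.
  have gd t : `|t| <= `|s| -> is_derive (x + t *: delta_mx 0 a) (delta_mx 0 a) g
      (partial a f (x + t *: delta_mx 0 a + s *: delta_mx 0 b) -
       partial a f (x + t *: delta_mx 0 a)).
    move=> ts; apply: is_deriveB; last first.
      apply: derivableP; apply: da.
      have := xd _ (@inball a b t 0 ts _).
      by rewrite scale0r addr0 normr0 normr_ge0 => /(_ isT) [].
    set z := x + _.
    have [Uz _] := xd _ (@inball a b t s ts (lexx _)).
    have E : (fun h : R => h^-1 *: (((fun w => f (w + s *: delta_mx 0 b)) \o shift z)
                       (h *: delta_mx 0 a)
                     - f (z + s *: delta_mx 0 b)))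
     = (fun h : R => h^-1 *: ((f \o shift (z + s *: delta_mx 0 b)) (h *: delta_mx 0 a)
                     - f (z + s *: delta_mx 0 b))).
      by apply/funext => h /=; congr (_ *: (f _ - _)); rewrite -addrA.
    split; first by rewrite /derivable E; exact: da.
    by rewrite /derive E.
  have [t ts|c cs Ec] := @MVT_line R _ g x (delta_mx 0 a) s.
    by have [] := gd t ts.
  have Eg := @derive_val _ _ _ _ _ _ _ (gd c cs).
  have [t ts|c' cs' Ec'] := 
    @MVT_line R _ (partial a f) (x + c *: delta_mx 0 a) (delta_mx 0 b) s.
    apply: db; by have [] := xd _ (@inball a b c t cs ts).
  exists (x + c *: delta_mx 0 a + c' *: delta_mx 0 b); first exact: inball.
  rewrite -/(partial b (partial a f) _) in Ec'.
  rewrite -Ec' -Eg -Ec /g (addrAC x).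
  by [].
have [y by_ Ey] := key i j di dji.
have [z bz Ez] := key j i dj dij.
have Eyz : partial j (partial i f) y = partial i (partial j f) z.
  have s0' : s != 0 by rewrite gt_eqF.
  apply: (mulfI s0'); apply: (mulfI s0'); apply: (etrans (esym Ey)).
  by apply: etrans Ez; rewrite (addrAC x) subrBB_swap.
have [_ [_ Hy]] := xd _ by_.
have [_ [Hz _]] := xd _ bz.
rewrite Eyz in Hy.
exact: ler_dist_half Hz Hy.
Qed.

(** * Calculus of partial derivatives *)

Lemma differentiable_big_sum (R : realType) (V : normedModType R) (I : Type)
    (r : seq I) (P : pred I) (F : I -> V -> R) x :
  (forall i, P i -> differentiable (F i) x) ->
  differentiable (fun y => \sum_(i <- r | P i) F i y) x.
Proof.
move=> dF; elim: r => [|i r IH].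
  rewrite (_ : (fun _ => _) = cst 0); first exact: differentiable_cst.
  by apply/funext => y; rewrite big_nil.
have [Pi|nPi] := boolP (P i); last first.
  rewrite (_ : (fun _ => _) = (fun y => \sum_(i <- r | P i) F i y)) //.
  by apply/funext => y; rewrite big_cons (negbTE nPi).
rewrite (_ : (fun _ => _) = F i + (fun y => \sum_(i <- r | P i) F i y)).
  by apply: differentiableD => //; exact: dF.
by apply/funext => y; rewrite big_cons Pi.
Qed.

Lemma differentiable_big_prod (R : realType) (V : normedModType R) (I : Type)
    (r : seq I) (P : pred I) (F : I -> V -> R) x :
  (forall i, P i -> differentiable (F i) x) ->
  differentiable (fun y => \prod_(i <- r | P i) F i y) x.
Proof.
move=> dF; elim: r => [|i r IH].
  rewrite (_ : (fun _ => _) = cst 1); first exact: differentiable_cst.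
  by apply/funext => y; rewrite big_nil.
have [Pi|nPi] := boolP (P i); last first.
  rewrite (_ : (fun _ => _) = (fun y => \prod_(i <- r | P i) F i y)) //.
  by apply/funext => y; rewrite big_cons (negbTE nPi).
rewrite (_ : (fun _ => _) = F i * (fun y => \prod_(i <- r | P i) F i y)).
  by apply: differentiableM => //; exact: dF.
by apply/funext => y; rewrite big_cons Pi.
Qed.

Lemma differentiable_mx (R : realType) (V : normedModType R) m n
    (A : V -> 'M[R]_(m, n)) x :
  (forall i j, differentiable (fun y => A y i j) x) -> differentiable A x.
Proof.
move=> dA.
rewrite (_ : A = \sum_i (\sum_j (fun y => A y i j *: delta_mx i j))); last first.
  apply/funext => y; rewrite {1}[A y]matrix_sum_delta fct_sumE.
  by apply: eq_bigr => i _; rewrite fct_sumE.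
by do 2 apply: differentiable_sum => ?; apply: differentiableZl.
Qed.

Lemma differentiable_entry (R : realType) (V : normedModType R) m n
    (A : V -> 'M[R]_(m, n)) x i j :
  differentiable A x -> differentiable (fun y => A y i j) x.
Proof.
move=> dA.
apply: (@differentiable_comp _ _ _ _ A (fun B : 'M[R]_(m, n) => B i j)) => //.
exact: differentiable_coord.
Qed.

Lemma differentiable_mulmx (R : realType) (V : normedModType R) m n p
    (A : V -> 'M[R]_(m, n)) (B : V -> 'M[R]_(n, p)) x :
  differentiable A x -> differentiable B x ->
  differentiable (fun y => A y *m B y) x.
Proof.
move=> dA dB; apply: differentiable_mx => i j.
rewrite (_ : (fun _ => _) = (fun y => \sum_k A y i k * B y k j)); last first.
  by apply/funext => y; rewrite !mxE.
apply: differentiable_big_sum => k _.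
by apply: differentiableM; exact: differentiable_entry.
Qed.

Lemma differentiable_trmx (R : realType) (V : normedModType R) m n
    (A : V -> 'M[R]_(m, n)) x :
  differentiable A x -> differentiable (fun y => (A y)^T) x.
Proof.
move=> dA; apply: differentiable_mx => i j.
rewrite (_ : (fun _ => _) = (fun y => A y j i)); last first.
  by apply/funext => y; rewrite !mxE.
exact: differentiable_entry.
Qed.

Lemma differentiable_det (R : realType) (V : normedModType R) n
    (A : V -> 'M[R]_n) x :
  differentiable A x -> differentiable (fun y => \det (A y)) x.
Proof.
move=> dA; rewrite /determinant; apply: differentiable_big_sum => s _.
apply: differentiableM; first exact: differentiable_cst.
by apply: differentiable_big_prod => i _; exact: differentiable_entry.
Qed.

Lemma near_eq_differentiable (R : realType) (V W : normedModType R)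
    (f g : V -> W) x :
  (\near x, f x = g x) -> differentiable f x -> differentiable g x.
Proof.
move=> fg /diff_locallyP [cdf E].
apply: (@differentiable_of_littleo _ _ _ _ ('d f x)) => //.
apply/eqaddoP => e e0; move/eqaddoP: E => /(_ e e0) Ef.
have fg0 : \forall h \near (0 : V), f (h + x) = g (h + x).
  by move: fg; rewrite (near_shift 0) subr0.
rewrite -(nbhs_singleton fg); apply: filterS2 fg0 Ef => h Eh.
by rewrite !fctE /= Eh.
Qed.

(** Cramer's rule writes the entries as cofactors divided by the determinant. Invertibility is asked
    on a neighbourhood because [invmx] returns a singular matrix unchanged. *)
Lemma differentiable_invmx (R : realType) (V : normedModType R) n
    (A : V -> 'M[R]_n) x :
  (\near x, A x \in unitmx) -> differentiable A x ->
  differentiable (fun y => invmx (A y)) x.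
Proof.
move=> uA dA; apply: differentiable_mx => i j.
have uAx := nbhs_singleton uA.
have E : \near x, (\det (A x))^-1 * cofactor (A x) j i = invmx (A x) i j.
  by near=> y; rewrite /invmx (near uA y) // !mxE.
suff d : differentiable (fun y => (\det (A y))^-1 * cofactor (A y) j i) x.
  exact: near_eq_differentiable E d.
apply: differentiableM.
  apply: differentiableV; last by rewrite -unitfE -unitmxE.
  exact: differentiable_det.
rewrite /cofactor; apply: differentiableM; first exact: differentiable_cst.
apply: differentiable_det; apply: differentiable_mx => k l.
rewrite (_ : (fun _ => _) = (fun y => A y (lift j k) (lift i l))); last first.
  by apply/funext => y; rewrite !mxE.
exact: differentiable_entry.
Unshelve. all: by end_near. Qed.

Section partial_rules.
Variables (R : realType) (m : nat).
Implicit Types (f g : 'rV[R]_m -> R) (x : 'rV[R]_m).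

Lemma partialE i f x : differentiable f x ->
  partial i f x = 'd f x (delta_mx 0 i).
Proof. exact: deriveE. Qed.

Lemma near_eq_partial i f g x : (\near x, f x = g x) ->
  partial i f x = partial i g x.
Proof. by move=> fg; exact: near_eq_derive. Qed.

Lemma partial_cst i (c : R) x : partial i (fun=> c) x = 0.
Proof. exact: derive_cst. Qed.

Lemma partialD i f g x : differentiable f x -> differentiable g x ->
  partial i (fun y => f y + g y) x = partial i f x + partial i g x.
Proof. by move=> df dg; apply: deriveD; exact: diff_derivable. Qed.

Lemma partialN i f x : differentiable f x ->
  partial i (fun y => - f y) x = - partial i f x.
Proof. by move=> df; apply: deriveN; exact: diff_derivable. Qed.

Lemma partialB i f g x : differentiable f x -> differentiable g x ->
  partial i (fun y => f y - g y) x = partial i f x - partial i g x.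
Proof. by move=> df dg; apply: deriveB; exact: diff_derivable. Qed.

Lemma partialM i f g x : differentiable f x -> differentiable g x ->
  partial i (fun y => f y * g y) x = partial i f x * g x + f x * partial i g x.
Proof.
move=> df dg; rewrite addrC [X in _ + X]mulrC.
by apply: deriveM; exact: diff_derivable.
Qed.

Lemma partial_big_sum i (I : Type) (r : seq I) (P : pred I)
    (F : I -> 'rV[R]_m -> R) x :
  (forall i, P i -> differentiable (F i) x) ->
  partial i (fun y => \sum_(j <- r | P j) F j y) x
  = \sum_(j <- r | P j) partial i (F j) x.
Proof.
move=> dF; elim: r => [|j r IH].
  rewrite big_nil (_ : (fun _ => _) = cst 0); first exact: derive_cst.
  by apply/funext => y; rewrite big_nil.
rewrite big_cons; have [Pj|nPj] := boolP (P j); last first.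
  rewrite -IH; congr partial.
  by apply/funext => y; rewrite big_cons (negbTE nPj).
rewrite -IH -partialD; last 2 first.
- exact: dF.
- exact: differentiable_big_sum.
by congr partial; apply/funext => y; rewrite big_cons Pj.
Qed.

Lemma diff_partial f x v : differentiable f x ->
  'd f x v = \sum_(i < m) v 0 i * partial i f x.
Proof.
move=> df; rewrite {1}[v]row_sum_delta linear_sum; apply: eq_bigr => i _.
by rewrite linearZ /= partialE.
Qed.

End partial_rules.

Lemma jacobianE (R : realType) m k (psi : 'rV[R]_m -> 'rV[R]_k) x i j :
  differentiable psi x ->
  'J psi x i j = partial i (fun y => psi y 0 j) x.
Proof.
move=> dpsi; rewrite /partial.
have := deriveEjacobian (delta_mx 0 i) dpsi.
rewrite derive_mx; last exact: diff_derivable.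
by move=> /rowP /(_ j); rewrite mxE -rowE mxE => ->; rewrite mxE.
Qed.

Lemma partial_comp (R : realType) m k (psi : 'rV[R]_m -> 'rV[R]_k)
    (g : 'rV[R]_k -> R) x i :
  differentiable psi x -> differentiable g (psi x) ->
  partial i (g \o psi) x = \sum_(j < k) 'J psi x i j * partial j g (psi x).
Proof.
move=> dpsi dg; rewrite partialE; last exact: differentiable_comp.
rewrite diff_comp //= diff_partial //; apply: eq_bigr => j _.
by congr (_ * _); rewrite /jacobian mxE.
Qed.

(** * Closure properties of C^k functions on an open set *)

Section smooth.
Variables (R : realType) (m : nat) (U : set 'rV[R]_m).
Hypothesis oU : open U.
Implicit Types (f g : 'rV[R]_m -> R) (x : 'rV[R]_m).

Lemma Ck_partial k i f : Ck k.+1 U f -> Ck k U (partial i f).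
Proof. by case=> _ /(_ i) []. Qed.

Lemma CkW k f : Ck k.+1 U f -> Ck k U f.
Proof.
elim: k f => [|k IH] f; first by case.
by case=> cf df; split=> // i; have [di /IH] := df i.
Qed.

Lemma smooth_on_differentiable f x : smooth_on U f -> U x -> differentiable f x.
Proof. by move=> sf; exact: C1_differentiable (sf 1%N). Qed.

Lemma smooth_on_partial i f : smooth_on U f -> smooth_on U (partial i f).
Proof. by move=> sf k; apply: Ck_partial. Qed.

Lemma eq_Ck k f g : (forall x, U x -> f x = g x) -> Ck k U f -> Ck k U g.
Proof.
have nU x : U x -> \near x, U x by move=> Ux; exact: open_nbhs_nbhs.
elim: k f g => [|k IH] f g fg [cf df]; split=> //.
- move=> x Ux; suff : g @ x --> g x by [].
  rewrite -(fg x Ux); apply: cvg_trans (cf x Ux); apply: (@near_eq_cvg _ _ (nbhs x)).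
  by apply: filterS (nU x Ux) => y; exact: fg.
- move=> x Ux; suff : g @ x --> g x by [].
  rewrite -(fg x Ux); apply: cvg_trans (cf x Ux); apply: (@near_eq_cvg _ _ (nbhs x)).
  by apply: filterS (nU x Ux) => y; exact: fg.
move=> i; have [di ci] := df i; split.
  move=> x Ux; apply: near_eq_derivable (di x Ux).
  by apply: filterS (nU x Ux) => y; exact: fg.
apply: IH ci => x Ux; apply: near_eq_partial.
by apply: filterS (nU x Ux) => y; exact: fg.
Qed.

Lemma eq_smooth_on f g : (forall x, U x -> f x = g x) ->
  smooth_on U f -> smooth_on U g.
Proof. by move=> fg sf k; exact: eq_Ck (sf k). Qed.

Lemma Ck_cst k (c : R) : Ck k U (fun=> c).
Proof.
elim: k c => [|k IH] c; split=> //; try by move=> x _; exact: cst_continuous.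
move=> i; split; first by move=> x _; exact: derivable_cst.
by apply: eq_Ck (IH 0) => x _; rewrite partial_cst.
Qed.

Lemma CkD k f g : Ck k U f -> Ck k U g -> Ck k U (fun x => f x + g x).
Proof.
elim: k f g => [|k IH] f g Cf Cg.
  split=> // x Ux; apply: continuousD; [exact: Cf.1|exact: Cg.1].
split.
  move=> x Ux; apply: continuousD; [exact: Cf.1|exact: Cg.1].
move=> i; split.
  by move=> x Ux; apply: derivableD; [exact: (Cf.2 i).1|exact: (Cg.2 i).1].
apply: eq_Ck (IH _ _ (Cf.2 i).2 (Cg.2 i).2) => x Ux.
by rewrite /partial deriveD //; [exact: (Cf.2 i).1|exact: (Cg.2 i).1].
Qed.

Lemma CkM k f g : Ck k U f -> Ck k U g -> Ck k U (fun x => f x * g x).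
Proof.
elim: k f g => [|k IH] f g Cf Cg.
  split=> // x Ux; apply: continuousM; [exact: Cf.1|exact: Cg.1].
split.
  move=> x Ux; apply: continuousM; [exact: Cf.1|exact: Cg.1].
move=> i; split.
  by move=> x Ux; apply: derivableM; [exact: (Cf.2 i).1|exact: (Cg.2 i).1].
apply: eq_Ck (CkD (IH _ _ (CkW Cf) (Cg.2 i).2) (IH _ _ (CkW Cg) (Cf.2 i).2)).
by move=> x Ux; rewrite /partial deriveM //; [exact: (Cf.2 i).1|exact: (Cg.2 i).1].
Qed.

Lemma Ck_sum k (I : Type) (r : seq I) (F : I -> 'rV[R]_m -> R) :
  (forall i, Ck k U (F i)) -> Ck k U (fun x => \sum_(i <- r) F i x).
Proof.
move=> CF; elim: r => [|i r IH].
  by apply: eq_Ck (Ck_cst k 0) => x _; rewrite big_nil.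
by apply: eq_Ck (CkD (CF i) IH) => x _; rewrite big_cons.
Qed.

End smooth.

(** [Ck] is a conjunction of pointwise conditions, so it may be tested with a set [V] that depends
    on the point. This serves both to restrict regularity to a smaller set and to glue it over a
    cover. *)
Lemma Ck_local (R : realType) m k (U : set 'rV[R]_m) f :
  (forall x, U x -> exists V : set 'rV[R]_m, V x /\ Ck k V f) -> Ck k U f.
Proof.
elim: k f => [|k IH] f H; split=> //.
- by move=> x /H [V [Vx []]] /(_ x Vx).
- by move=> x /H [V [Vx []]] /(_ x Vx).
move=> i; split; first by move=> x /H [V [Vx [_ /(_ i) [/(_ x Vx)]]]].
by apply: IH => x /H [V [Vx [_ /(_ i) [_ ?]]]]; exists V.
Qed.

(** * Bilinear forms, Christoffel symbols and curvature *)

Section inner.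
Variables (R : realType) (k : nat).
Implicit Types (G : 'M[R]_k) (u v w : 'rV[R]_k) (a : R).

Lemma innerE G u v :
  inner G u v = \sum_i \sum_j G i j * u 0 i * v 0 j.
Proof.
rewrite /inner mxE exchange_big /=; apply: eq_bigr => j _.
rewrite !mxE big_distrl /=; apply: eq_bigr => i _.
by rewrite [u 0 i * _]mulrC.
Qed.

Lemma innerDl G u v w : inner G (u + v) w = inner G u w + inner G v w.
Proof. by rewrite /inner !mulmxDl mxE. Qed.

Lemma innerDr G u v w : inner G u (v + w) = inner G u v + inner G u w.
Proof. by rewrite /inner linearD mulmxDr mxE. Qed.

Lemma innerNl G u v : inner G (- u) v = - inner G u v.
Proof. by rewrite /inner !mulNmx mxE. Qed.

Lemma innerBl G u v w : inner G (u - v) w = inner G u w - inner G v w.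
Proof. by rewrite innerDl innerNl. Qed.

Lemma innerZl G a u v : inner G (a *: u) v = a * inner G u v.
Proof. by rewrite /inner -!scalemxAl mxE. Qed.

Lemma innerZr G a u v : inner G u (a *: v) = a * inner G u v.
Proof. by rewrite /inner linearZ -scalemxAr mxE. Qed.

Lemma inner_suml G (I : Type) (r : seq I) (P : pred I) (F : I -> 'rV[R]_k) v :
  inner G (\sum_(i <- r | P i) F i) v = \sum_(i <- r | P i) inner G (F i) v.
Proof. by rewrite /inner !mulmx_suml summxE. Qed.

Lemma inner_sumr G (I : Type) (r : seq I) (P : pred I) (F : I -> 'rV[R]_k) v :
  inner G v (\sum_(i <- r | P i) F i) = \sum_(i <- r | P i) inner G v (F i).
Proof. by rewrite /inner linear_sum mulmx_sumr summxE. Qed.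

Lemma inner_mxD G G' u v : inner (G + G') u v = inner G u v + inner G' u v.
Proof. by rewrite /inner mulmxDr mulmxDl mxE. Qed.

Lemma inner_mxZ G a u v : inner (a *: G) u v = a * inner G u v.
Proof. by rewrite /inner -scalemxAr -scalemxAl mxE. Qed.

Lemma inner_mx_sum (I : Type) (r : seq I) (P : pred I) (F : I -> 'M[R]_k) u v :
  inner (\sum_(i <- r | P i) F i) u v = \sum_(i <- r | P i) inner (F i) u v.
Proof. by rewrite /inner mulmx_sumr mulmx_suml summxE. Qed.

Lemma inner_tr G u v : inner G^T u v = inner G v u.
Proof.
rewrite /inner -[RHS](mxE trmx_key (fun i j => (v *m G *m u^T) j i)) -/(trmx _).
by rewrite !trmx_mul trmxK mulmxA.
Qed.

Lemma inner_sym G u v : G^T = G -> inner G u v = inner G v u.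
Proof. by move=> sG; rewrite -{1}sG inner_tr. Qed.

Lemma inner_delta G i j : inner G (delta_mx 0 i) (delta_mx 0 j) = G i j.
Proof. by rewrite /inner -rowE trmx_delta -colE !mxE. Qed.

Lemma inner_deltar G u j : inner G u (delta_mx 0 j) = (u *m G) 0 j.
Proof. by rewrite /inner trmx_delta -colE !mxE. Qed.

End inner.

(** For a parametrization [psi], the row [dmx i psi x] is its i-th coordinate tangent vector.
    Locked, like the tensors below, so that rewriting does not unfold it. *)
HB.lock Definition dmx (R : realType) m p q (i : 'I_m)
    (A : 'rV[R]_m -> 'M[R]_(p, q)) (x : 'rV[R]_m) : 'M[R]_(p, q) :=
  \matrix_(a, b) partial i (fun y => A y a b) x.

Lemma dmxE (R : realType) m p q i (A : 'rV[R]_m -> 'M[R]_(p, q))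
    (x : 'rV[R]_m) a b :
  dmx i A x a b = partial i (fun y => A y a b) x.
Proof. by rewrite unlock mxE. Qed.

Section dmx.
Variables (R : realType) (m : nat).

Lemma near_eq_dmx p q i (A B : 'rV[R]_m -> 'M[R]_(p, q))
    (x : 'rV[R]_m) :
  (\near x, A x = B x) -> dmx i A x = dmx i B x.
Proof.
move=> AB; apply/matrixP => a b; rewrite !dmxE.
by apply: near_eq_partial; apply: filterS AB => y ->.
Qed.

Lemma dmx_mul p q r i (A : 'rV[R]_m -> 'M[R]_(p, q))
    (B : 'rV[R]_m -> 'M[R]_(q, r)) (x : 'rV[R]_m) :
  differentiable A x -> differentiable B x ->
  dmx i (fun y => A y *m B y) x = dmx i A x *m B x + A x *m dmx i B x.
Proof.
move=> dA dB; apply/matrixP => a b; rewrite dmxE [RHS]mxE [in RHS]mxE.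
rewrite [X in _ + X]mxE -big_split /=.
under eq_fun do rewrite mxE.
rewrite partial_big_sum => [|j _]; last first.
  by apply: differentiableM; exact: differentiable_entry.
apply: eq_bigr => j _; rewrite !dmxE partialM //; exact: differentiable_entry.
Qed.

Lemma dmxD p q i (A B : 'rV[R]_m -> 'M[R]_(p, q))
    (x : 'rV[R]_m) :
  differentiable A x -> differentiable B x ->
  dmx i (fun y => A y + B y) x = dmx i A x + dmx i B x.
Proof.
move=> dA dB; apply/matrixP => a b; rewrite dmxE [RHS]mxE !dmxE.
under eq_fun do rewrite mxE.
by rewrite partialD //; exact: differentiable_entry.
Qed.

Lemma dmx_tr p q i (A : 'rV[R]_m -> 'M[R]_(p, q))
    (x : 'rV[R]_m) :
  dmx i (fun y => (A y)^T) x = (dmx i A x)^T.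
Proof.
by apply/matrixP => a b; rewrite dmxE [RHS]mxE dmxE; under eq_fun do rewrite mxE.
Qed.

Lemma dmx_cst p q i (A : 'M[R]_(p, q)) (x : 'rV[R]_m) : dmx i (fun=> A) x = 0.
Proof. by apply/matrixP => a b; rewrite dmxE mxE partial_cst. Qed.

Lemma partial_inner k i (M : 'rV[R]_m -> 'M[R]_k) (u v : 'rV[R]_m -> 'rV[R]_k)
    (x : 'rV[R]_m) :
  differentiable M x -> differentiable u x -> differentiable v x ->
  partial i (fun y => inner (M y) (u y) (v y)) x
  = inner (dmx i M x) (u x) (v x) + inner (M x) (dmx i u x) (v x)
    + inner (M x) (u x) (dmx i v x).
Proof.
move=> dM du dv.
have := dmx_mul i (differentiable_mulmx du dM) (differentiable_trmx dv).
rewrite (dmx_mul i du dM) (dmx_tr i v x) => /matrixP /(_ 0 0).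
have E (A B : 'M[R]_1) : (A + B) 0 0 = A 0 0 + B 0 0 by rewrite mxE.
rewrite mulmxDl !E dmxE => ->.
by rewrite [X in X + _]addrC.
Qed.

Lemma differentiable_inner k (V : normedModType R) (M : V -> 'M[R]_k)
    (u v : V -> 'rV[R]_k) x :
  differentiable M x -> differentiable u x -> differentiable v x ->
  differentiable (fun y => inner (M y) (u y) (v y)) x.
Proof.
move=> dM du dv; apply: differentiable_entry.
by apply: differentiable_mulmx; [exact: differentiable_mulmx|exact: differentiable_trmx].
Qed.

End dmx.

Lemma dmx_comp (R : realType) m k p q (psi : 'rV[R]_m -> 'rV[R]_k)
    (A : 'rV[R]_k -> 'M[R]_(p, q)) (x : 'rV[R]_m) i :
  differentiable psi x -> differentiable A (psi x) ->
  dmx i (A \o psi) x = \sum_(r < k) dmx i psi x 0 r *: dmx r A (psi x).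
Proof.
move=> dpsi dA; apply/matrixP => a b; rewrite summxE dmxE.
rewrite (@partial_comp _ _ _ psi (fun y => A y a b)) //; last exact: differentiable_entry.
by apply: eq_bigr => r _; rewrite jacobianE // mxE !dmxE.
Qed.

HB.lock Definition chr (R : realType) k (G : 'rV[R]_k -> 'M[R]_k) (l : 'I_k) y :
  'M[R]_k :=
  \matrix_(p, q) christoffel G l p q y.

(** Christoffel term Gamma(u, v) for arbitrary vectors: nabla_u v is the derivative along u of the
    components of v plus [gam G y u v]. *)
HB.lock Definition gam (R : realType) k (G : 'rV[R]_k -> 'M[R]_k) y (u v : 'rV[R]_k) :
  'rV[R]_k := \row_l inner (chr G l y) u v.

HB.lock Definition dirmx (R : realType) k p q (A : 'rV[R]_k -> 'M[R]_(p, q)) y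
    (u : 'rV[R]_k) : 'M[R]_(p, q) :=
  \sum_r u 0 r *: dmx r A y.

(** The vector R(u, v) w, in the sign convention of [riemann]: the formula for [riemann] contracted
    with three vectors, so that identities can be stated without indices. *)
HB.lock Definition curv (R : realType) k (G : 'rV[R]_k -> 'M[R]_k) y
    (u v w : 'rV[R]_k) : 'rV[R]_k :=
  \row_l (inner (dirmx (chr G l) y u) v w - inner (dirmx (chr G l) y v) u w
          + inner (chr G l y) u (gam G y v w) - inner (chr G l y) v (gam G y u w)).

Lemma gamE (R : realType) k (G : 'rV[R]_k -> 'M[R]_k) y (u v : 'rV[R]_k) l :
  gam G y u v 0 l = inner (chr G l y) u v.
Proof. by rewrite unlock mxE. Qed.

Lemma chrE (R : realType) k (G : 'rV[R]_k -> 'M[R]_k) l y p q :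
  chr G l y p q = christoffel G l p q y.
Proof. by rewrite unlock mxE. Qed.

Lemma curvE (R : realType) k (G : 'rV[R]_k -> 'M[R]_k) y (u v w : 'rV[R]_k) l :
  curv G y u v w 0 l
  = inner (dirmx (chr G l) y u) v w - inner (dirmx (chr G l) y v) u w
    + inner (chr G l y) u (gam G y v w) - inner (chr G l y) v (gam G y u w).
Proof. by rewrite unlock mxE. Qed.


Section linearity.
Variables (R : realType) (k : nat) (G : 'rV[R]_k -> 'M[R]_k) (y : 'rV[R]_k).
Implicit Types u v w : 'rV[R]_k.

Lemma gamDl u v w : gam G y (u + v) w = gam G y u w + gam G y v w.
Proof. by apply/rowP => l; rewrite [RHS]mxE !gamE innerDl. Qed.

Lemma gamDr u v w : gam G y u (v + w) = gam G y u v + gam G y u w.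
Proof. by apply/rowP => l; rewrite [RHS]mxE !gamE innerDr. Qed.

Lemma gamZl a u w : gam G y (a *: u) w = a *: gam G y u w.
Proof. by apply/rowP => l; rewrite [RHS]mxE !gamE innerZl. Qed.

Lemma gamZr a u w : gam G y u (a *: w) = a *: gam G y u w.
Proof. by apply/rowP => l; rewrite [RHS]mxE !gamE innerZr. Qed.

Lemma dirmxD p q (A : 'rV[R]_k -> 'M[R]_(p, q)) u v :
  dirmx A y (u + v) = dirmx A y u + dirmx A y v.
Proof.
by rewrite unlock -big_split; apply: eq_bigr => r _; rewrite mxE scalerDl.
Qed.

Lemma dirmxZ p q (A : 'rV[R]_k -> 'M[R]_(p, q)) a u :
  dirmx A y (a *: u) = a *: dirmx A y u.
Proof.
by rewrite unlock scaler_sumr; apply: eq_bigr => r _; rewrite mxE scalerA.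
Qed.

Lemma dirmx_delta p q (A : 'rV[R]_k -> 'M[R]_(p, q)) r :
  dirmx A y (delta_mx 0 r) = dmx r A y.
Proof.
rewrite unlock (bigD1 r) //= big1 => [|s sr].
  by rewrite addr0 mxE !eqxx scale1r.
by rewrite mxE (negbTE sr) andbF scale0r.
Qed.

Lemma curvDl u u' v w : curv G y (u + u') v w = curv G y u v w + curv G y u' v w.
Proof.
apply/rowP => l; rewrite [RHS]mxE !curvE dirmxD inner_mxD !innerDl gamDl innerDr.
by ring.
Qed.

Lemma curvZl a u v w : curv G y (a *: u) v w = a *: curv G y u v w.
Proof.
apply/rowP => l; rewrite [RHS]mxE !curvE dirmxZ inner_mxZ !innerZl gamZl innerZr.
by ring.
Qed.

Lemma curv_anti u v w : curv G y u v w = - curv G y v u w.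
Proof. by apply/rowP => l; rewrite [RHS]mxE !curvE; ring. Qed.

Lemma curvDr u v w w' : curv G y u v (w + w') = curv G y u v w + curv G y u v w'.
Proof.
apply/rowP => l; rewrite [RHS]mxE !curvE !gamDr !innerDr.
by ring.
Qed.

Lemma curvZr a u v w : curv G y u v (a *: w) = a *: curv G y u v w.
Proof.
apply/rowP => l; rewrite [RHS]mxE !curvE !gamZr !innerZr.
by ring.
Qed.

Lemma curv_suml (I : Type) (r : seq I) (F : I -> 'rV[R]_k) v w :
  curv G y (\sum_(i <- r) F i) v w = \sum_(i <- r) curv G y (F i) v w.
Proof.
elim: r => [|i r IH]; last by rewrite !big_cons curvDl IH.
by rewrite !big_nil -[X in curv _ _ X](scale0r v) curvZl scale0r.
Qed.

(** Reduces identities for R(u, v) to coordinate vectors, for which the commutator formula with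
    [psi = id] is available. *)
Lemma curv_delta u v w :
  curv G y u v w
  = \sum_i \sum_j (u 0 i * v 0 j) *: curv G y (delta_mx 0 i) (delta_mx 0 j) w.
Proof.
rewrite {1}[u]row_sum_delta curv_suml; apply: eq_bigr => i _.
rewrite curvZl curv_anti {1}[v]row_sum_delta curv_suml scalerN scaler_sumr -sumrN.
apply: eq_bigr => j _.
by rewrite curvZl curv_anti scalerN scalerN opprK scalerA.
Qed.

Lemma riemannE l p q r :
  curv G y (delta_mx 0 p) (delta_mx 0 q) (delta_mx 0 r) 0 l = riemann G l r p q y.
Proof.
have A a b : inner (dmx a (chr G l) y) (delta_mx 0 b) (delta_mx 0 r)
    = partial a (christoffel G l b r) y.
  by rewrite inner_delta dmxE; congr partial; apply/funext => z; rewrite chrE.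
have B a b : inner (chr G l y) (delta_mx 0 a) (gam G y (delta_mx 0 b) (delta_mx 0 r))
    = \sum_h christoffel G l a h y * christoffel G h b r y.
  rewrite innerE (bigD1 a) //= [X in _ + X]big1 ?addr0 => [|s sp].
    apply: eq_bigr => h _; rewrite gamE inner_delta !chrE.
    by rewrite mxE !eqxx mulr1.
  by apply: big1 => h _; rewrite (mxE _ _ 0 s) (negbTE sp) andbF mulr0 mul0r.
rewrite curvE !dirmx_delta (A p q) (A q p) (B p q) (B q p).
by rewrite /riemann big_split sumrN /= addrA.
Qed.

Lemma ricciE v w :
  inner (ricci G y) v w = \sum_i curv G y (delta_mx 0 i) v w 0 i.
Proof.
have lin_v i : curv G y (delta_mx 0 i) v w
   = \sum_q v 0 q *: curv G y (delta_mx 0 i) (delta_mx 0 q) w.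
  rewrite curv_anti {1}[v]row_sum_delta curv_suml -sumrN.
  by apply: eq_bigr => q _; rewrite curvZl -scalerN -curv_anti.
have lin_w i v' : curv G y (delta_mx 0 i) v' w
   = \sum_q w 0 q *: curv G y (delta_mx 0 i) v' (delta_mx 0 q).
  rewrite {1}[w]row_sum_delta; elim: (index_enum _) => [|q r IH].
    by rewrite !big_nil -[X in curv _ _ _ _ X](scale0r w) curvZr scale0r.
  by rewrite !big_cons curvDr curvZr IH.
transitivity (\sum_i \sum_p \sum_q v 0 p * (w 0 q * riemann G i q i p y)).
  rewrite innerE [RHS]exchange_big /=; apply: eq_bigr => p _.
  rewrite [RHS]exchange_big /=; apply: eq_bigr => q _.
  rewrite mxE -mulrA mulr_suml; apply: eq_bigr => i _.
  by rewrite mulrC -mulrA.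
apply: eq_bigr => i _; rewrite lin_v summxE; apply: eq_bigr => p _.
rewrite mxE lin_w summxE big_distrr /=; apply: eq_bigr => q _.
by rewrite mxE riemannE.
Qed.

End linearity.

(** * Covariant derivatives along a map *)

(* Only invertible, so that Lorentzian metrics are included. *)
Record smooth_metric (R : realType) k (V : set 'rV[R]_k)
    (G : 'rV[R]_k -> 'M[R]_k) : Prop := SmoothMetric {
  smetric_open : open V;
  smetric_smooth : forall i j, smooth_on V (fun y => G y i j);
  smetric_sym : forall y, V y -> (G y)^T = G y;
  smetric_unit : forall y, V y -> G y \in unitmx }.

Lemma near_open (R : realType) k (V : set 'rV[R]_k) y :
  open V -> V y -> \near y, V y.
Proof. by move=> oV Vy; exact: open_nbhs_nbhs. Qed.

Section smooth_metric.
Variables (R : realType) (k : nat) (V : set 'rV[R]_k) (G : 'rV[R]_k -> 'M[R]_k).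
Hypothesis sG : smooth_metric V G.

Let oV := smetric_open sG.

Lemma metric_entry_sym y i j : V y -> G y i j = G y j i.
Proof. by move=> Vy; rewrite -{1}(smetric_sym sG Vy) mxE. Qed.

Lemma partial_metric_sym y r i j : V y ->
  partial r (fun z => G z i j) y = partial r (fun z => G z j i) y.
Proof.
move=> Vy; apply: near_eq_partial; apply: filterS (near_open oV Vy) => z Vz.
exact: metric_entry_sym.
Qed.

Lemma differentiable_metric y : V y -> differentiable G y.
Proof.
move=> Vy; apply: differentiable_mx => i j.
by apply: (smooth_on_differentiable oV) Vy; exact: smetric_smooth sG i j.
Qed.

Lemma differentiable_partial_metric y r i j : V y ->
  differentiable (partial r (fun z => G z i j)) y.
Proof.
move=> Vy; apply: (smooth_on_differentiable oV) Vy.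
by apply: smooth_on_partial; exact: smetric_smooth sG i j.
Qed.

Lemma differentiable_christoffel y l i j : V y ->
  differentiable (christoffel G l i j) y.
Proof.
move=> Vy; apply: differentiableM; first exact: differentiable_cst.
apply: differentiable_big_sum => h _; apply: differentiableM.
  apply: differentiable_entry; apply: differentiable_invmx.
    by apply: filterS (near_open oV Vy) => z; exact: smetric_unit.
  exact: differentiable_metric.
by apply: differentiableB; [apply: differentiableD|];
  exact: differentiable_partial_metric.
Qed.

Lemma differentiable_chr y l : V y -> differentiable (chr G l) y.
Proof.
move=> Vy; apply: differentiable_mx => i j.
by under eq_fun do rewrite chrE; exact: differentiable_christoffel.
Qed.

Lemma christoffel_sym y l i j : V y ->
  christoffel G l i j y = christoffel G l j i y.
Proof.
move=> Vy; rewrite /christoffel; congr (_ * _); apply: eq_bigr => h _.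
congr (_ * (_ - _)); first exact: addrC.
exact: partial_metric_sym.
Qed.

Lemma gam_sym y u v : V y -> gam G y u v = gam G y v u.
Proof.
move=> Vy; apply/rowP => l; rewrite !gamE; apply: inner_sym.
by apply/matrixP => i j; rewrite mxE !chrE christoffel_sym.
Qed.

(** Lowering the upper index cancels the inverse metric and leaves the Christoffel symbols of the
    first kind. *)
Lemma christoffel_lower y h i j : V y ->
  \sum_l G y h l * christoffel G l i j y
  = 2^-1 * (partial i (fun z => G z j h) y + partial j (fun z => G z i h) y
            - partial h (fun z => G z i j) y).
Proof.
move=> Vy; pose b : 'cV[R]_k := \col_h (partial i (fun z => G z j h) y
  + partial j (fun z => G z i h) y - partial h (fun z => G z i j) y).
have E l : christoffel G l i j y = 2^-1 * (invmx (G y) *m b) l 0.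
  rewrite /christoffel mxE; congr (_ * _).
  by apply: eq_bigr => p _; rewrite [b _ _]mxE.
under eq_bigr do rewrite E mulrCA.
rewrite -mulr_sumr; congr (_ * _).
transitivity ((G y *m (invmx (G y) *m b)) h 0); first by rewrite [RHS]mxE.
by rewrite mulmxA mulmxV ?mul1mx ?mxE //; exact: smetric_unit sG _ Vy.
Qed.

Lemma partial_metric y r p q : V y ->
  partial r (fun z => G z p q) y
  = \sum_l (G y q l * christoffel G l r p y + G y p l * christoffel G l r q y).
Proof.
move=> Vy; rewrite big_split /= !christoffel_lower //.
rewrite (partial_metric_sym q r p Vy) (partial_metric_sym p r q Vy).
rewrite (partial_metric_sym r q p Vy).
move: (partial r _ y) (partial p _ y) (partial q _ y) => a b c.
by field.
Qed.

(** Compatibility of the connection with the metric: [partial_metric] contracted with three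
    vectors. *)
Lemma dirmx_metric y u v w : V y ->
  inner (dirmx G y u) v w
  = inner (G y) (gam G y u v) w + inner (G y) v (gam G y u w).
Proof.
move=> Vy.
have red u' v' w' : inner (G y) v' (gam G y u' w')
   = \sum_r \sum_p \sum_q u' 0 r * v' 0 p * w' 0 q
       * (\sum_l G y p l * christoffel G l r q y).
  rewrite innerE.
  transitivity (\sum_p \sum_r \sum_q u' 0 r * v' 0 p * w' 0 q
       * (\sum_l G y p l * christoffel G l r q y)); last exact: exchange_big.
  apply: eq_bigr => p _.
  under eq_bigr do rewrite gamE innerE mulr_sumr.
  rewrite exchange_big /=; apply: eq_bigr => r _.
  under eq_bigr do rewrite mulr_sumr.
  rewrite exchange_big /=; apply: eq_bigr => q _.
  rewrite mulr_sumr; apply: eq_bigr => l _; rewrite chrE.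
  by move: (G y p l) (christoffel _ _ _ _ _) => a b; ring.
rewrite (inner_sym _ _ (smetric_sym sG Vy)) !red unlock inner_mx_sum.
rewrite -big_split /=; apply: eq_bigr => r _.
rewrite inner_mxZ innerE mulr_sumr.
rewrite [X in _ = X + _]exchange_big -big_split /=; apply: eq_bigr => p _.
rewrite mulr_sumr -big_split; apply: eq_bigr => q _ /=.
rewrite dmxE partial_metric // big_split /=.
by move: (\sum_l _) (\sum_l _) => a b; ring.
Qed.

End smooth_metric.

Section connection_along.
Variables (R : realType) (m k : nat) (U : set 'rV[R]_m) (V : set 'rV[R]_k).
Variables (G : 'rV[R]_k -> 'M[R]_k) (psi : 'rV[R]_m -> 'rV[R]_k).
Hypotheses (oU : open U) (sG : smooth_metric V G).
Hypothesis psiV : forall x, U x -> V (psi x).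
Hypothesis spsi : forall j, smooth_on U (fun x => psi x 0 j).
Implicit Types (x : 'rV[R]_m) (A B : 'rV[R]_m -> 'rV[R]_k) (i j : 'I_m).

(** The pulled-back connection on fields along [psi], tangent to the image or not. With [psi = id]
    it is the connection of [G] itself, a case from which curvature identities are derived. *)
Definition cov i A x : 'rV[R]_k :=
  dmx i A x + gam G (psi x) (dmx i psi x) (A x).

Lemma differentiable_psi x : U x -> differentiable psi x.
Proof.
move=> Ux; apply: differentiable_mx => a j; rewrite (ord1 a).
by apply: (smooth_on_differentiable oU) Ux; exact: spsi.
Qed.

Lemma cov_inner i A B x : U x -> differentiable A x -> differentiable B x ->
  partial i (fun y => inner (G (psi y)) (A y) (B y)) x
  = inner (G (psi x)) (cov i A x) (B x) + inner (G (psi x)) (A x) (cov i B x).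
Proof.
move=> Ux dA dB.
have dpsi := differentiable_psi Ux.
have dG := differentiable_metric sG (psiV Ux).
rewrite (@partial_inner _ _ _ _ (G \o psi)) //; last exact: differentiable_comp.
rewrite (dmx_comp _ dpsi dG).
have := @dirmx_metric _ _ _ _ sG (psi x) (dmx i psi x) (A x) (B x) (psiV Ux).
rewrite unlock => ->; rewrite /cov innerDl innerDr /=.
by move: (inner _ _ _) (inner _ _ _) (inner _ _ _) (inner _ _ _) => a b c d; ring.
Qed.

Definition smooth_field A := forall j : 'I_k, smooth_on U (fun x => A x 0 j).

Lemma smooth_field_differentiable A x : smooth_field A -> U x -> differentiable A x.
Proof.
move=> sA Ux; apply: differentiable_mx => a j; rewrite (ord1 a).
by apply: (smooth_on_differentiable oU) Ux; exact: sA.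
Qed.

Lemma smooth_field_dmx i A : smooth_field A -> smooth_field (dmx i A).
Proof.
by move=> sA j; under eq_fun do rewrite dmxE; exact: smooth_on_partial.
Qed.

Lemma dmx_comm i j A x : smooth_field A -> U x ->
  dmx i (dmx j A) x = dmx j (dmx i A) x.
Proof.
move=> sA Ux; apply/rowP => l; rewrite !dmxE.
under eq_fun do rewrite dmxE.
under [in RHS]eq_fun do rewrite dmxE.
exact: (partial_comm _ _ oU (sA l 2%N)).
Qed.

Lemma differentiable_gam (B C : 'rV[R]_m -> 'rV[R]_k) x : U x ->
  differentiable B x -> differentiable C x ->
  differentiable (fun y => gam G (psi y) (B y) (C y)) x.
Proof.
move=> Ux dB dC; apply: differentiable_mx => a l; rewrite (ord1 a).
under eq_fun do rewrite gamE.
apply: (@differentiable_inner _ _ _ (chr G l \o psi)) => //.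
apply: differentiable_comp; first exact: differentiable_psi.
exact: differentiable_chr sG _ _ (psiV Ux).
Qed.

Lemma differentiable_cov i A x : smooth_field A -> U x ->
  differentiable (cov i A) x.
Proof.
move=> sA Ux; apply: differentiableD.
  exact: smooth_field_differentiable (smooth_field_dmx i sA) Ux.
apply: differentiable_gam => //.
  exact: smooth_field_differentiable (smooth_field_dmx i spsi) Ux.
exact: smooth_field_differentiable.
Qed.

Lemma dmx_gam i (B C : 'rV[R]_m -> 'rV[R]_k) x l : U x ->
  differentiable B x -> differentiable C x ->
  dmx i (fun y => gam G (psi y) (B y) (C y)) x 0 l
  = inner (dirmx (chr G l) (psi x) (dmx i psi x)) (B x) (C x)
    + inner (chr G l (psi x)) (dmx i B x) (C x)
    + inner (chr G l (psi x)) (B x) (dmx i C x).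
Proof.
move=> Ux dB dC; rewrite dmxE; under eq_fun do rewrite gamE.
have dpsi := differentiable_psi Ux.
have dchr := differentiable_chr sG l (psiV Ux).
rewrite (@partial_inner _ _ _ _ (chr G l \o psi)) //; last exact: differentiable_comp.
by rewrite (dmx_comp _ dpsi dchr) [dirmx]unlock.
Qed.

(** Coordinate fields commute, so no bracket term appears. The second derivatives of [A] and of
    [psi] agree in both orders, and the terms in first derivatives of [A] are symmetric in the two
    indices; what survives is [curv]. *)
Lemma cov_comm i j A x : smooth_field A -> U x ->
  cov i (cov j A) x - cov j (cov i A) x
  = curv G (psi x) (dmx i psi x) (dmx j psi x) (A x).
Proof.
move=> sA Ux; apply/rowP => l.
have dA := smooth_field_differentiable sA Ux.
have ddA i' := smooth_field_differentiable (smooth_field_dmx i' sA) Ux.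
have dE i' := smooth_field_differentiable (smooth_field_dmx i' spsi) Ux.
have sub (u v : 'rV[R]_k) : (u - v) 0 l = u 0 l - v 0 l by rewrite !mxE.
have add (u v : 'rV[R]_k) : (u + v) 0 l = u 0 l + v 0 l by rewrite !mxE.
have H a b : cov a (cov b A) x 0 l
  = dmx a (dmx b A) x 0 l
    + (inner (dirmx (chr G l) (psi x) (dmx a psi x)) (dmx b psi x) (A x)
       + inner (chr G l (psi x)) (dmx a (dmx b psi) x) (A x)
       + inner (chr G l (psi x)) (dmx b psi x) (dmx a A x))
    + (inner (chr G l (psi x)) (dmx a psi x) (dmx b A x)
       + inner (chr G l (psi x)) (dmx a psi x)
           (gam G (psi x) (dmx b psi x) (A x))).
  rewrite {1}/cov add gamE {2}/cov innerDr; congr (_ + _).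
  rewrite /cov (dmxD a (ddA b) (differentiable_gam Ux (dE b) dA)) add.
  by rewrite (dmx_gam a l Ux (dE b) dA).
rewrite sub !H curvE (dmx_comm i j sA Ux) (@dmx_comm i j psi x spsi Ux).
set a1 := inner _ _ _; set a2 := inner _ _ _; set a3 := inner _ _ _.
set a4 := inner _ _ _; set a5 := inner _ _ _; set a6 := inner _ _ _.
set a7 := inner _ _ _; set a8 := dmx _ _ _ _ _.
by rewrite !opprD !addrA; lra.
Qed.

(** The connection is torsion-free: mixed derivatives of [psi] agree and the Christoffel symbols are
    symmetric. *)
Lemma cov_tangent_sym i j x : U x -> cov i (dmx j psi) x = cov j (dmx i psi) x.
Proof.
move=> Ux; rewrite /cov (@dmx_comm i j psi x spsi Ux).
by rewrite (gam_sym sG _ _ (psiV Ux)).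
Qed.

End connection_along.

Lemma partial_coord (R : realType) k (i j : 'I_k) (y : 'rV[R]_k) :
  partial i (fun z => z 0 j) y = (i == j)%:R.
Proof.
have di : differentiable (id : 'rV[R]_k -> 'rV[R]_k) y by [].
have := derive_mx (@diff_derivable _ _ _ _ _ (delta_mx 0 i : 'rV[R]_k) di).
move=> /rowP /(_ j); rewrite derive_id [RHS]mxE => E.
rewrite -[LHS]/('D_(delta_mx 0 i) (fun t : 'rV[R]_k => id t 0 j) y) -E.
by rewrite mxE eqxx /= eq_sym.
Qed.

Lemma dmx_id (R : realType) k (i : 'I_k) (y : 'rV[R]_k) :
  dmx i id y = delta_mx 0 i.
Proof.
by apply/rowP => j; rewrite dmxE partial_coord mxE eqxx /= eq_sym.
Qed.

Lemma smooth_on_cst (R : realType) k (V : set 'rV[R]_k) (c : R) :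
  open V -> smooth_on V (fun=> c).
Proof. by move=> oV n; exact: Ck_cst. Qed.

Lemma smooth_on_coord (R : realType) k (V : set 'rV[R]_k) (j : 'I_k) :
  open V -> smooth_on V (fun y : 'rV[R]_k => y 0 j).
Proof.
move=> oV n; have cj y : {for y, continuous (fun y : 'rV[R]_k => y 0 j)}.
  exact: differentiable_continuous (differentiable_coord _ _ _).
case: n => [|n]; split=> // i; split.
  by move=> y _; apply: diff_derivable; exact: differentiable_coord.
by apply: eq_Ck (Ck_cst oV n (i == j)%:R) => // y _; rewrite partial_coord.
Qed.

(** Mixed second derivatives of <W, W> agree for the constant field [W = w]. Expanded by metric
    compatibility, their difference is 2 <R(e_i, e_j) w, w>, since the products of first derivatives
    are symmetric in i and j. *)
Lemma curv_metric_anti (R : realType) k (V : set 'rV[R]_k)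
    (G : 'rV[R]_k -> 'M[R]_k) y u v w :
  smooth_metric V G -> V y -> inner (G y) (curv G y u v w) w = 0.
Proof.
move=> sG Vy; have oV := smetric_open sG.
have psiV z : V z -> V (id z) by [].
have spsi (j : 'I_k) : smooth_on V (fun z : 'rV[R]_k => id z 0 j).
  exact: smooth_on_coord.
pose W (z : 'rV[R]_k) : 'rV[R]_k := w.
have sW : smooth_field V W by move=> j; exact: smooth_on_cst.
have dW z : differentiable W z by exact: differentiable_cst.
have dcW i z : V z -> differentiable (cov G id i W) z.
  exact: (differentiable_cov oV sG psiV spsi i sW).
pose g z := inner (G z) (W z) (W z).
have Cg : Ck 2 V g.
  apply: eq_Ck (Ck_sum oV (index_enum 'I_k) (fun i =>
    Ck_sum oV (index_enum 'I_k) (fun j => CkM oV (smetric_smooth sG i j 2%N)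
      (Ck_cst oV 2 (w 0 i * w 0 j))))) => // z Vz.
  by rewrite /g innerE; apply: eq_bigr => i _; apply: eq_bigr => j _; rewrite mulrA.
have pg i z : V z -> partial i g z = 2 * inner (G z) (cov G id i W z) (W z).
  move=> Vz; rewrite /g (cov_inner oV sG psiV spsi i Vz (dW z) (dW z)).
  by rewrite (inner_sym (W z) _ (smetric_sym sG Vz)) mulr2n mulrDl mul1r.
have ppg i j : partial i (partial j g) y
  = 2 * (inner (G y) (cov G id i (cov G id j W) y) w
         + inner (G y) (cov G id j W y) (cov G id i W y)).
  rewrite (@near_eq_partial _ _ i _ (fun z => 2 * inner (G z) (cov G id j W z) (W z))).
    rewrite partialM ?partial_cst ?mul0r ?add0r; last 2 first.
    - exact: differentiable_cst.
    - apply: differentiable_inner => //; last exact: dcW.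
      exact: (differentiable_metric sG).
    by rewrite (cov_inner oV sG psiV spsi i Vy (dcW j y Vy) (dW y)).
  by apply: filterS (near_open oV Vy) => z; exact: pg.
have base i j : inner (G y) (curv G y (delta_mx 0 i) (delta_mx 0 j) w) w = 0.
  have := cov_comm oV sG psiV spsi i j sW Vy; rewrite !dmx_id => <-.
  have := partial_comm i j oV Cg Vy; rewrite !ppg => /mulfI.
  move=> /(_ (negbT (pnatr_eq0 R 2))).
  rewrite innerBl (inner_sym (cov G id i W y) _ (smetric_sym sG Vy)).
  by move=> /addIr ->; rewrite subrr.
rewrite curv_delta inner_suml big1 // => i _.
by rewrite inner_suml big1 // => j _; rewrite innerZl base mulr0.
Qed.

(** * Spacelike hypersurfaces of Lorentzian manifolds *)

Section lorentz_frame.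
Variables (R : realType) (n : nat) (G : 'M[R]_(1 + n)).
Variables (E : 'I_n -> 'rV[R]_(1 + n)) (N : 'rV[R]_(1 + n)) (g : 'M[R]_n).
Hypothesis symG : G^T = G.
Hypothesis ug : g \in unitmx.
Hypothesis gE : forall i j, g i j = inner G (E i) (E j).
Hypothesis NN : inner G N N = -1.
Hypothesis NE : forall i, inner G N (E i) = 0.

Let J : 'M[R]_(n, 1 + n) := \matrix_i E i.

Let MJ (v : 'rV[R]_(1 + n)) M i : (v *m M *m J^T) 0 i = inner M v (E i).
Proof.
rewrite /inner !mxE; apply: eq_bigr => l _.
by rewrite !mxE.
Qed.

Let JMJ A M i j : (J *m A *m M *m J^T) i j = inner M (E i *m A) (E j).
Proof.
transitivity (row i (J *m A *m M *m J^T) 0 j); first by rewrite [RHS]mxE.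
by rewrite !row_mul rowK MJ.
Qed.

Let JGJ : J *m G *m J^T = g.
Proof.
apply/matrixP => i j; rewrite gE.
transitivity ((J *m 1%:M *m G *m J^T) i j); first by rewrite mulmx1.
by rewrite JMJ mulmx1.
Qed.

(** The frame N, E_1, ..., E_n has Gram matrix diag(-1, g), with inverse [D]. For square matrices
    the right inverse in [BsK] is also a left inverse; the resulting factorization of the identity,
    inserted into [v] and into [\tr M], gives the two lemmas below. *)
Let Bs : 'M[R]_(1 + n) := col_mx N J.
Let D : 'M[R]_(1 + n) := block_mx (-1) 0 0 (invmx g).

Let BsK : Bs *m (G *m Bs^T *m D) = 1%:M.
Proof.
have NNm : N *m G *m N^T = (-1)%:M.
  by apply/matrixP => i j; rewrite !ord1 [LHS]NN !mxE eqxx mulr1n.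
have NJm : N *m G *m J^T = 0.
  by apply/rowP => j; rewrite MJ NE mxE.
have JNm : J *m G *m N^T = 0.
  by apply: trmx_inj; rewrite !trmx_mul trmxK symG mulmxA NJm trmx0.
rewrite !mulmxA /Bs mul_col_mx tr_col_mx mul_col_row NNm NJm JNm JGJ.
rewrite /D mulmx_block !mul0mx !mulmx0 !addr0 !add0r mulmxV //.
by rewrite mulmxN mulmx1 -raddfN opprK -scalar_mx_block.
Qed.

Lemma frame_decomp v :
  v = - inner G v N *: N
      + \sum_i \sum_j (inner G v (E i) * invmx g i j) *: E j.
Proof.
have /mulmx1C DBs := BsK.
rewrite -{1}[v]mulmx1 -DBs !mulmxA /Bs tr_col_mx mul_mx_row /D mul_row_block.
rewrite !mulmx0 addr0 add0r mul_row_col; congr (_ + _).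
  rewrite mulmxN mulmx1 mulNmx scaleNr; congr (- _).
  by rewrite [_ *m N^T]mx11_scalar mul_scalar_mx.
rewrite exchange_big /= -mulmxA.
apply/rowP => l; rewrite mulmxA mxE summxE; apply: eq_bigr => j _.
rewrite summxE mxE mulr_suml; apply: eq_bigr => i _.
by rewrite MJ !mxE.
Qed.

Lemma frame_trace (M : 'M[R]_(1 + n)) :
  \tr M = - inner G (N *m M) N
          + \sum_i \sum_j invmx g i j * inner G (E i *m M) (E j).
Proof.
have /mulmx1C DBs := BsK.
rewrite -[in LHS](mulmx1 M) -DBs !mulmxA mxtrace_mulC !mulmxA.
rewrite /Bs mul_col_mx mul_col_mx tr_col_mx mul_col_row /D mulmx_block.
rewrite mxtrace_block !mulmx0 !addr0 !add0r; congr (_ + _).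
  by rewrite mulmxN mulmx1 /mxtrace big_ord1 mxE.
have sg : g^T = g.
  by apply/matrixP => i j; rewrite mxE !gE; exact: inner_sym.
have sgi i j : invmx g j i = invmx g i j.
  by rewrite -{1}sg -trmx_inv mxE.
rewrite /mxtrace; apply: eq_bigr => i _.
rewrite mxE; apply: eq_bigr => j _; rewrite mulrC sgi; congr (_ * _).
exact: JMJ.
Qed.

End lorentz_frame.

Lemma invmx_sym (R : realType) n (g : 'M[R]_n) i j :
  g^T = g -> invmx g i j = invmx g j i.
Proof. by move=> sg; rewrite -{1}sg -trmx_inv mxE. Qed.

(** [M] is meant to be an inverse metric, which makes this the contraction g^{ij} F_ij. *)
Definition metric_trace (R : realType) n (M : 'M[R]_n) (F : 'I_n -> 'I_n -> R) : R :=
  \sum_i \sum_j M i j * F i j.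

(* S is the matrix of Y |-> nabla_Y N, that is, of - A. *)
Section hypersurface.
Variables (R : realType) (n : nat) (U : set 'rV[R]_n) (V : set 'rV[R]_(1 + n)).
Variables (G : 'rV[R]_(1 + n) -> 'M[R]_(1 + n)) (psi : 'rV[R]_n -> 'rV[R]_(1 + n)).
Variables (g : 'rV[R]_n -> 'M[R]_n) (N : 'rV[R]_n -> 'rV[R]_(1 + n)).
Variables (S : 'rV[R]_n -> 'M[R]_n) (c0 : R).
Hypotheses (sG : smooth_metric V G) (sg : smooth_metric U g).
Hypothesis psiV : forall x, U x -> V (psi x).
Hypothesis spsi : forall j, smooth_on U (fun x => psi x 0 j).
Hypothesis sN : smooth_field U N.

Local Notation E i x := (dmx i psi x).
Local Notation W i x := (cov G psi i N x).
Local Notation B i j x := (cov G psi i (dmx j psi) x).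
Local Notation Z i j x := (cov G psi i (cov G psi j N) x).
Local Notation ip x := (inner (G (psi x))).
Local Notation chris k i j x := (christoffel g k i j x).
Local Notation tr2 x F := (metric_trace (invmx (g x)) F).

Hypothesis gE : forall x i j, U x -> g x i j = ip x (E i x) (E j x).
Hypothesis NN : forall x, U x -> ip x (N x) (N x) = -1.
Hypothesis NE : forall x i, U x -> ip x (N x) (E i x) = 0.
Hypothesis SE : forall x i, U x -> W i x = \sum_k S x i k *: E k x.
Hypothesis trS : forall x, U x -> \tr (S x) = c0.

Let oU := smetric_open sg.
Let symG x u v : U x -> ip x u v = ip x v u.
Proof. by move=> Ux; exact: inner_sym (smetric_sym sG (psiV Ux)). Qed.

Let dE i x : U x -> differentiable (dmx i psi) x.
Proof.
by move=> Ux; exact: smooth_field_differentiable (smooth_field_dmx i spsi) Ux.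
Qed.

Let dN x : U x -> differentiable N x.
Proof. exact: smooth_field_differentiable. Qed.

Let dW i x : U x -> differentiable (cov G psi i N) x.
Proof. exact: (differentiable_cov oU sG psiV spsi). Qed.

Let near_partial i (f h : 'rV[R]_n -> R) x : U x ->
  (forall y, U y -> f y = h y) -> partial i f x = partial i h x.
Proof.
by move=> Ux fh; apply: near_eq_partial; apply: filterS (near_open oU Ux).
Qed.

Let covI i A C x : U x -> differentiable A x -> differentiable C x ->
  partial i (fun y => ip y (A y) (C y)) x
  = ip x (cov G psi i A x) (C x) + ip x (A x) (cov G psi i C x).
Proof. exact: (cov_inner oU sG psiV spsi). Qed.

Lemma weingarten_tangent i x : U x -> ip x (W i x) (N x) = 0.
Proof.
move=> Ux; rewrite SE // inner_suml big1 // => k _.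
by rewrite innerZl symG // NE // mulr0.
Qed.

(** Derivative of <N, E_j> = 0. The left-hand side h_ij = <W_i, E_j> serves as second fundamental
    form in what follows. *)
Lemma second_form i j x : U x -> ip x (W i x) (E j x) = - ip x (N x) (B i j x).
Proof.
move=> Ux; have := covI i Ux (dN Ux) (dE j Ux).
rewrite (near_partial i (h := fun=> 0) Ux) => [|y Uy]; last exact: NE.
rewrite partial_cst => /esym/eqP; rewrite addr_eq0 => /eqP E0.
exact: E0.
Qed.

Let Bsym i j x : U x -> B i j x = B j i x.
Proof. exact: (cov_tangent_sym oU sG psiV spsi). Qed.

Lemma second_form_sym i j x : U x -> ip x (W i x) (E j x) = ip x (W j x) (E i x).
Proof. by move=> Ux; rewrite !second_form // Bsym. Qed.

Lemma second_formE i j x : U x ->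
  ip x (W i x) (E j x) = \sum_k S x i k * g x k j.
Proof.
move=> Ux; rewrite SE // inner_suml; apply: eq_bigr => k _.
by rewrite innerZl gE.
Qed.

Lemma partial_induced i j l x : U x ->
  partial i (fun y => g y j l) x
  = ip x (B i j x) (E l x) + ip x (E j x) (B i l x).
Proof.
move=> Ux; rewrite -(covI i Ux (dE j Ux) (dE l Ux)).
by apply: (near_partial i Ux) => y Uy; exact: gE.
Qed.

(** Koszul's formula for [g], where the symmetry of [B] makes the three derivatives collapse: the
    tangential part of the ambient connection is the induced Levi-Civita connection. *)
Lemma christoffel_induced i j l x : U x ->
  \sum_k g x l k * chris k i j x = ip x (B i j x) (E l x).
Proof.
move=> Ux; rewrite (christoffel_lower sg) // !partial_induced //.
rewrite (Bsym l i) // (Bsym l j) // (Bsym j i) //.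
rewrite (symG (E j x)) // (symG (E i x)) //.
move: (ip x _ _) (ip x _ _) (ip x _ _) => a b c.
by field.
Qed.

Let decomp v x : U x ->
  v = - ip x v (N x) *: N x
      + \sum_i \sum_j (ip x v (E i x) * invmx (g x) i j) *: E j x.
Proof.
move=> Ux; exact: (frame_decomp (smetric_sym sG (psiV Ux)) (smetric_unit sg Ux)
  (fun i j => gE i j Ux) (NN Ux) (fun i => NE i Ux)).
Qed.

(** The normal coefficient carries a plus sign: <N, N> = -1 makes it -<B_ij, N>, which is <W_i, E_j>
    by [second_form]. *)
Lemma gauss_formula i j x : U x ->
  B i j x = \sum_k chris k i j x *: E k x + ip x (W i x) (E j x) *: N x.
Proof.
move=> Ux; rewrite addrC {1}(decomp (B i j x) Ux); congr (_ + _).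
  by rewrite second_form // (symG (N x)).
rewrite exchange_big /=; apply: eq_bigr => k _; rewrite -scaler_suml.
congr (_ *: _).
transitivity ((invmx (g x) *m (g x *m \col_k chris k i j x)) k 0).
  rewrite mxE; apply: eq_bigr => l _; rewrite mulrC.
  rewrite (invmx_sym _ _ (smetric_sym sg Ux)); congr (_ * _).
  rewrite mxE -christoffel_induced //; apply: eq_bigr => h _.
  by rewrite [(\col__ _) _ _]mxE.
by rewrite mulmxA mulVmx ?mul1mx ?mxE //; exact: smetric_unit sg _ Ux.
Qed.

(** In the trace over the frame N, E_1, ..., E_n the normal term <R(N, v) N, N> vanishes by
    antisymmetry, so only tangent directions remain. *)
Lemma ricci_induced_trace v x : U x ->
  inner (ricci G (psi x)) v (N x)
  = tr2 x (fun i j => ip x (curv G (psi x) (E i x) v (N x)) (E j x)).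
Proof.
move=> Ux; rewrite ricciE /metric_trace.
pose C : 'M[R]_(1 + n) := \matrix_i curv G (psi x) (delta_mx 0 i) v (N x).
have CE u : u *m C = curv G (psi x) u v (N x).
  rewrite mulmx_sum_row {2}[u]row_sum_delta curv_suml.
  by apply: eq_bigr => i _; rewrite rowK curvZl.
transitivity (\tr C); first by apply: eq_bigr => i _; rewrite mxE.
rewrite (frame_trace (smetric_sym sG (psiV Ux)) (smetric_unit sg Ux)
  (fun i j => gE i j Ux) (NN Ux) (fun i => NE i Ux) C).
rewrite CE (curv_metric_anti _ _ _ sG (psiV Ux)) oppr0 add0r.
by apply: eq_bigr => i _; apply: eq_bigr => j _; rewrite CE.
Qed.

Lemma differentiable_second_form i j x : U x ->
  differentiable (fun y => ip y (W i y) (E j y)) x.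
Proof.
move=> Ux; apply: (@differentiable_inner _ _ _ (G \o psi)).
- apply: differentiable_comp; first exact: (differentiable_psi oU spsi).
  exact: differentiable_metric sG _ (psiV Ux).
- exact: dW.
- exact: dE.
Qed.

Lemma weingartenE i k x : U x ->
  S x i k = \sum_l ip x (W i x) (E l x) * invmx (g x) l k.
Proof.
move=> Ux; rewrite -[S x in LHS](mulmxK (smetric_unit sg Ux)) mxE.
by apply: eq_bigr => l _; rewrite second_formE // mxE.
Qed.

(** The regularity of [S] comes from [weingartenE], which solves for it through the inverse
    metric. *)
Lemma differentiable_weingarten i k x : U x ->
  differentiable (fun y => S y i k) x.
Proof.
move=> Ux; apply: (@near_eq_differentiable _ _ _
    (fun y => \sum_l ip y (W i y) (E l y) * invmx (g y) l k)).
  by apply: filterS (near_open oU Ux) => y Uy; rewrite weingartenE.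
apply: differentiable_big_sum => l _; apply: differentiableM.
  exact: differentiable_second_form.
apply: differentiable_entry; apply: differentiable_invmx.
  by apply: filterS (near_open oU Ux) => y; exact: smetric_unit.
exact: differentiable_metric sg _ Ux.
Qed.

Lemma partial_second_form i j l x : U x ->
  partial i (fun y => ip y (W j y) (E l y)) x
  = ip x (Z i j x) (E l x) + ip x (W j x) (B i l x).
Proof. by move=> Ux; exact: covI Ux (dW j Ux) (dE l Ux). Qed.

(** Product rule for <W_i, E_j> = sum_k S_ik g_kj. It trades derivatives of [W] for derivatives of
    the entries of [S], whose trace is constant. *)
Lemma cov_weingarten l i j x : U x ->
  ip x (Z l i x) (E j x)
  = \sum_k (partial l (fun y => S y i k) x * g x k j
            + S x i k * ip x (B l k x) (E j x)).
Proof.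
move=> Ux; have := partial_second_form l i j Ux.
rewrite (near_partial l (h := fun y => \sum_k S y i k * g y k j) Ux); last first.
  by move=> y Uy; exact: second_formE.
rewrite partial_big_sum => [E1|k _]; last first.
  apply: differentiableM; first exact: differentiable_weingarten.
  exact: differentiable_entry (differentiable_metric sg Ux).
apply: (addIr (ip x (W i x) (B l j x))); rewrite -E1.
rewrite [X in _ = _ + X](_ : _ = \sum_k S x i k * ip x (E k x) (B l j x)); last first.
  by rewrite SE // inner_suml; apply: eq_bigr => k _; rewrite innerZl.
rewrite -big_split; apply: eq_bigr => k _ /=.
rewrite partialM; last 2 first.
- exact: differentiable_weingarten.
- exact: differentiable_entry (differentiable_metric sg Ux).
by rewrite partial_induced // mulrDr addrA.
Qed.

Lemma partial_trace l x : U x -> \sum_k partial l (fun y => S y k k) x = 0.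
Proof.
move=> Ux; rewrite -partial_big_sum => [|k _]; last exact: differentiable_weingarten.
by rewrite (near_partial l (h := fun=> c0) Ux) ?partial_cst.
Qed.

Let gisym x i j : U x -> invmx (g x) i j = invmx (g x) j i.
Proof. by move=> Ux; exact: invmx_sym (smetric_sym sg Ux). Qed.

Lemma weingarten_sym i k x : U x -> (invmx (g x) *m S x) i k = (invmx (g x) *m S x) k i.
Proof.
move=> Ux; pose h := \matrix_(i, j) ip x (W i x) (E j x).
have -> : S x = h *m invmx (g x).
  apply/matrixP => a b; rewrite weingartenE // mxE.
  by apply: eq_bigr => l _; rewrite mxE.
have sh : h^T = h by apply/matrixP => a b; rewrite !mxE second_form_sym.
have E0 : (invmx (g x) *m (h *m invmx (g x)))^T = invmx (g x) *m (h *m invmx (g x)).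
  by rewrite !trmx_mul trmx_inv (smetric_sym sg Ux) sh mulmxA.
by rewrite -[in LHS]E0 mxE.
Qed.

(** Contracted Codazzi equation. In general div h - d(tr h) = Ric(., N), and constant mean curvature
    removes d(tr h). The expression under the trace is the covariant derivative (nabla_i h)_jl,
    since <W_j, B_il> cancels the other Christoffel term. *)
Lemma codazzi l x : U x ->
  tr2 x (fun i j => ip x (Z i j x) (E l x)
                    - \sum_k chris k i j x * ip x (W k x) (E l x))
  = inner (ricci G (psi x)) (E l x) (N x).
Proof.
move=> Ux; rewrite ricci_induced_trace //.
(* The symmetry h_jl = h_lj passes from [Z i j] to [Z i l]; commuting the derivatives i and l then
   produces the curvature, whose trace is the Ricci term. The remaining bracket has to have trace
   zero. *)
have H i j : ip x (Z i j x) (E l x) - \sum_k chris k i j x * ip x (W k x) (E l x)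
  = ip x (curv G (psi x) (E i x) (E l x) (N x)) (E j x)
    + (ip x (Z l i x) (E j x) - ip x (W j x) (B i l x)).
  have H1 := partial_second_form i j l Ux.
  have H2 := partial_second_form i l j Ux.
  rewrite (near_partial i (h := fun y => ip y (W j y) (E l y)) Ux) in H2; last first.
    by move=> y Uy; exact: second_form_sym.
  rewrite H1 in H2.
  have := cov_comm oU sG psiV spsi i l sN Ux => <-.
  rewrite innerBl.
  have -> : \sum_k chris k i j x * ip x (W k x) (E l x) = ip x (W l x) (B i j x).
    rewrite (gauss_formula i j Ux) innerDr innerZr weingarten_tangent // mulr0 addr0.
    rewrite inner_sumr; apply: eq_bigr => k _.
    by rewrite innerZr second_form_sym.
  move: H2; set a1 := inner _ _ _; set a2 := inner _ _ _.
  set a3 := inner _ _ _; set a4 := inner _ _ _; set a5 := inner _ _ _.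
  by move=> H2; lra.
rewrite /metric_trace; under eq_bigr do under eq_bigr do rewrite H mulrDr.
under eq_bigr do rewrite big_split /=.
rewrite big_split /= -[RHS]addr0; congr (_ + _).
under eq_bigr do under eq_bigr do rewrite mulrBr.
under eq_bigr do rewrite sumrB.
rewrite sumrB; apply/eqP; rewrite subr_eq0; apply/eqP.
(* [cov_weingarten] splits off the derivative of [\tr S], which is zero. What is left matches the
   other half of the bracket because [invmx (g x) *m S x] is symmetric. *)
have -> : \sum_i \sum_j invmx (g x) i j * ip x (Z l i x) (E j x)
    = \sum_k \sum_j (invmx (g x) *m S x) j k * ip x (B l k x) (E j x).
  under eq_bigr do under eq_bigr do rewrite cov_weingarten // big_split /= mulrDr.
  under eq_bigr do rewrite big_split /=.
  rewrite big_split /= [X in X + _](_ : _ = 0) ?add0r; last first.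
    rewrite -[RHS](partial_trace l Ux); apply: eq_bigr => i _.
    transitivity (\sum_k partial l (fun y => S y i k) x * (g x *m invmx (g x)) k i).
      under eq_bigr do rewrite mulr_sumr.
      rewrite exchange_big /=; apply: eq_bigr => k _.
      rewrite mxE mulr_sumr; apply: eq_bigr => j _.
      by rewrite (gisym i j Ux) mulrCA [invmx _ _ _ * _]mulrC.
    rewrite mulmxV ?(smetric_unit sg Ux) // (bigD1 i) //= big1 ?addr0 => [|k ki].
      by rewrite mxE eqxx mulr1.
    by rewrite mxE (negbTE ki) mulr0.
  under eq_bigr do under eq_bigr do rewrite mulr_sumr.
  under eq_bigr do rewrite exchange_big /=.
  rewrite exchange_big /=; apply: eq_bigr => k _.
  rewrite exchange_big /=; apply: eq_bigr => j _.
  rewrite mxE mulr_suml; apply: eq_bigr => i _.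
  by rewrite mulrA (gisym i j Ux).
have -> : \sum_i \sum_j invmx (g x) i j * ip x (W j x) (B i l x)
    = \sum_k \sum_j (invmx (g x) *m S x) j k * ip x (E k x) (B l j x).
  rewrite [RHS]exchange_big /=; apply: eq_bigr => i _.
  under eq_bigr do rewrite SE // inner_suml mulr_sumr.
  rewrite exchange_big /=; apply: eq_bigr => k _.
  rewrite mxE mulr_suml; apply: eq_bigr => j _.
  by rewrite innerZl mulrA (Bsym i l).
rewrite exchange_big /=; apply: eq_bigr => j _; apply: eq_bigr => k _.
by rewrite weingarten_sym // symG.
Qed.

Let tr2D x (F H : 'I_n -> 'I_n -> R) :
  tr2 x (fun i j => F i j + H i j) = tr2 x F + tr2 x H.
Proof.
rewrite -big_split; apply: eq_bigr => i _; rewrite -big_split /=.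
by apply: eq_bigr => j _; rewrite mulrDr.
Qed.

Let tr2Z x a (F : 'I_n -> 'I_n -> R) :
  tr2 x (fun i j => a * F i j) = a * tr2 x F.
Proof.
rewrite mulr_sumr; apply: eq_bigr => i _; rewrite mulr_sumr.
by apply: eq_bigr => j _; rewrite mulrCA.
Qed.

Let eq_tr2 x (F H : 'I_n -> 'I_n -> R) :
  (forall i j, F i j = H i j) -> tr2 x F = tr2 x H.
Proof. by move=> FH; do 2 apply: eq_bigr => ? _; rewrite FH. Qed.

Let tr2_sum x (I : finType) (F : I -> 'I_n -> 'I_n -> R) :
  tr2 x (fun i j => \sum_a F a i j) = \sum_a tr2 x (F a).
Proof.
rewrite [RHS]exchange_big; apply: eq_bigr => i _; rewrite [RHS]exchange_big.
by apply: eq_bigr => j _; rewrite mulr_sumr.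
Qed.

Lemma tr2_second_form x : U x -> tr2 x (fun i j => ip x (W i x) (E j x)) = c0.
Proof.
move=> Ux; rewrite -(trS Ux); apply: eq_bigr => i _.
by rewrite weingartenE //; apply: eq_bigr => l _; rewrite mulrC (gisym i l Ux).
Qed.

Lemma tr2_induced x : U x -> tr2 x (fun i j => g x i j) = n%:R.
Proof.
move=> Ux; transitivity (\tr (invmx (g x) *m g x)).
  rewrite /mxtrace; apply: eq_bigr => i _; rewrite mxE; apply: eq_bigr => j _.
  by rewrite (metric_entry_sym sg i j Ux).
by rewrite mulVmx ?mxtrace1 // (smetric_unit sg Ux).
Qed.

Lemma tr2_third_form x : U x ->
  tr2 x (fun i j => ip x (W j x) (W i x)) = \tr (S x *m S x).
Proof.
move=> Ux; rewrite /mxtrace; apply: eq_bigr => i _.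
under eq_bigr do rewrite [X in inner _ _ X]SE // inner_sumr mulr_sumr.
rewrite exchange_big mxE /=; apply: eq_bigr => k _.
rewrite (weingartenE k i Ux) mulr_sumr; apply: eq_bigr => j _.
by rewrite innerZr mulrCA (second_form_sym k j Ux) (gisym i j Ux) [invmx _ _ _ * _]mulrC.
Qed.

Lemma cov_weingarten_normal i j x : U x ->
  ip x (Z i j x) (N x) = - ip x (W j x) (W i x).
Proof.
move=> Ux; have := covI i Ux (dW j Ux) (dN Ux).
rewrite (near_partial i (h := fun=> 0) Ux) => [|y Uy]; last exact: weingarten_tangent.
by rewrite partial_cst => /esym/eqP; rewrite addr_eq0 => /eqP.
Qed.

(* In a warped product T = d_t, cc = (f'/f)(tau) and dc = (f'/f)'(tau); then
   t i = <E i, T> below is minus the i-th partial derivative of tau. *)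
Section angle.
Variables (T : 'rV[R]_n -> 'rV[R]_(1 + n)) (cc dc : 'rV[R]_n -> R).
Hypothesis TT : forall x, U x -> ip x (T x) (T x) = -1.
Hypothesis dT : forall x, U x -> differentiable T x.
Hypothesis covT : forall x i, U x ->
  cov G psi i T x = cc x *: (E i x + ip x (E i x) (T x) *: T x).
Hypothesis dcc : forall x, U x -> differentiable cc x.
Hypothesis partial_cc : forall x i, U x ->
  partial i cc x = - dc x * ip x (E i x) (T x).

Local Notation u x := (ip x (N x) (T x)).
Local Notation t i x := (ip x (E i x) (T x)).

Let du x : U x -> differentiable (fun y => u y) x.
Proof.
move=> Ux; apply: (@differentiable_inner _ _ _ (G \o psi)).
- apply: differentiable_comp; first exact: (differentiable_psi oU spsi).
  exact: differentiable_metric sG _ (psiV Ux).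
- exact: dN.
- exact: dT.
Qed.

Let dt i x : U x -> differentiable (fun y => t i y) x.
Proof.
move=> Ux; apply: (@differentiable_inner _ _ _ (G \o psi)).
- apply: differentiable_comp; first exact: (differentiable_psi oU spsi).
  exact: differentiable_metric sG _ (psiV Ux).
- exact: dE.
- exact: dT.
Qed.

Let dw i x : U x -> differentiable (fun y => ip y (W i y) (T y)) x.
Proof.
move=> Ux; apply: (@differentiable_inner _ _ _ (G \o psi)).
- apply: differentiable_comp; first exact: (differentiable_psi oU spsi).
  exact: differentiable_metric sG _ (psiV Ux).
- exact: dW.
- exact: dT.
Qed.

Lemma partial_angle j x : U x ->
  partial j (fun y => u y) x = ip x (W j x) (T x) + cc x * (t j x * u x).
Proof.
move=> Ux; rewrite covI //; [|exact: dN|exact: dT].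
by rewrite covT // innerZr innerDr NE // innerZr add0r.
Qed.

Lemma partial_height i j x : U x ->
  partial i (fun y => t j y) x
  = ip x (B i j x) (T x) + cc x * (g x i j + t i x * t j x).
Proof.
move=> Ux; rewrite covI //; [|exact: dE|exact: dT].
by rewrite covT // innerZr innerDr innerZr (symG (E j x) (E i x)) // -gE.
Qed.

Lemma partial_partial_angle i j x : U x ->
  partial i (partial j (fun y => u y)) x
  = ip x (Z i j x) (T x)
    + cc x * (ip x (W i x) (E j x) + t i x * ip x (W j x) (T x))
    - dc x * t i x * (t j x * u x)
    + cc x * ((ip x (B i j x) (T x) + cc x * (g x i j + t i x * t j x)) * u x
              + t j x * (ip x (W i x) (T x) + cc x * (t i x * u x))).
Proof.
move=> Ux.
rewrite (near_partial i (h := fun y => ip y (W j y) (T y) + cc y * (t j y * u y)) Ux);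
  last exact: partial_angle.
have dtu : differentiable (fun y => t j y * u y) x.
  by apply: differentiableM; [exact: dt|exact: du].
rewrite (partialD _ (dw j Ux) (differentiableM (dcc Ux) dtu)).
rewrite (partialM _ (dcc Ux) dtu) (partialM _ (dt j Ux) (du Ux)).
rewrite covI //; [|exact: dW|exact: dT].
rewrite covT // innerZr innerDr innerZr partial_cc // partial_height //.
rewrite partial_angle //.
rewrite (second_form_sym j i Ux).
by rewrite addrA !mulNr.
Qed.

(** Each summand is a function times a bilinear form in i and j, ready for the metric trace. The
    Gauss formula applied to [B] cancels the Christoffel terms in t_k; those in [W] complete [Z i j]
    to the form handled by [tr2_rough_laplacian]. *)
Lemma hessian_angle i j x : U x ->
  partial i (partial j (fun y => u y)) x
    - \sum_k chris k i j x * partial k (fun y => u y) x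
  = (ip x (Z i j x) (T x) - \sum_k chris k i j x * ip x (W k x) (T x))
    + ((cc x * (1 + u x ^+ 2)) * ip x (W i x) (E j x)
    + (cc x * (t i x * ip x (W j x) (T x))
    + (cc x * (t j x * ip x (W i x) (T x))
    + ((2 * cc x ^+ 2 * u x - dc x * u x) * (t i x * t j x)
    + (cc x ^+ 2 * u x) * g x i j)))).
Proof.
move=> Ux; rewrite partial_partial_angle //.
have -> : \sum_k chris k i j x * partial k (fun y => u y) x
  = \sum_k chris k i j x * ip x (W k x) (T x)
    + cc x * u x * \sum_k chris k i j x * t k x.
  rewrite mulr_sumr -big_split; apply: eq_bigr => k _ /=.
  rewrite partial_angle //.
  by move: (chris _ _ _ _) (ip _ _ _) (ip _ _ _) (ip _ _ _) => a b c d; ring.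
have -> : ip x (B i j x) (T x)
  = \sum_k chris k i j x * t k x + ip x (W i x) (E j x) * u x.
  rewrite (gauss_formula i j Ux) innerDl innerZl inner_suml; congr (_ + _).
  by apply: eq_bigr => k _; rewrite innerZl.
move: (\sum_k _) (\sum_k _) (ip x (Z i j x) _) (ip x (W i x) (E j x)) (u x) => a b z h v.
move: (ip x (W i x) _) (ip x (W j x) _) (t i x) (t j x) => wi wj ti tj.
move: (g x i j) (cc x) (dc x) => gij c d.
by ring.
Qed.

Let T_decomp x : U x ->
  T x = - u x *: N x + \sum_i \sum_j (t i x * invmx (g x) i j) *: E j x.
Proof.
move=> Ux; rewrite {1}(decomp (T x) Ux) (symG (T x)) //; congr (_ + _).
by do 2 apply: eq_bigr => ? _; rewrite (symG (T x)).
Qed.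

(** The trace is |grad tau|^2. The decomposition of [T] paired with [T] reads -1 = -u^2 + |grad
    tau|^2. *)
Lemma tr2_height x : U x -> tr2 x (fun i j => t i x * t j x) = u x ^+ 2 - 1.
Proof.
move=> Ux; have := TT Ux; rewrite {1}(T_decomp Ux) innerDl innerZl inner_suml.
under eq_bigr do rewrite inner_suml.
under eq_bigr do under eq_bigr do rewrite innerZl mulrAC mulrC.
rewrite mulNr -expr2 => E0.
by apply: (addrI (- u x ^+ 2)); rewrite E0 addKr.
Qed.

Lemma weingarten_T j x : U x -> ip x (W j x) (T x) = \sum_k S x j k * t k x.
Proof.
by move=> Ux; rewrite SE // inner_suml; apply: eq_bigr => k _; rewrite innerZl.
Qed.

Lemma tr2_height_weingarten x : U x ->
  tr2 x (fun i j => t i x * ip x (W j x) (T x))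
  = inner (invmx (g x) *m S x) (\row_i t i x) (\row_i t i x).
Proof.
move=> Ux; rewrite innerE; apply: eq_bigr => i _.
under eq_bigr do rewrite weingarten_T // mulrCA mulr_sumr.
under eq_bigr do rewrite mulr_sumr.
rewrite exchange_big /=; apply: eq_bigr => k _.
rewrite !mxE -mulrA mulr_suml; apply: eq_bigr => j _.
by move: (invmx _ _ _) (S _ _ _) (t _ _) (t _ _) => a b c d; ring.
Qed.

(** Split [T] into -u N and its tangential part T + u N. The normal part contributes u tr(S^2), by
    differentiating <W_j, N> = 0; the tangential part contributes Ric(T + u N, N), by [codazzi]. *)
Lemma tr2_rough_laplacian x : U x ->
  tr2 x (fun i j => ip x (Z i j x) (T x)
                    - \sum_k chris k i j x * ip x (W k x) (T x))
  = u x * \tr (S x *m S x) + inner (ricci G (psi x)) (T x) (N x)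
    + u x * inner (ricci G (psi x)) (N x) (N x).
Proof.
move=> Ux.
have ipT v : ip x v (T x)
    = - u x * ip x v (N x)
      + \sum_a \sum_b (t a x * invmx (g x) a b) * ip x v (E b x).
  rewrite {1}(T_decomp Ux) innerDr innerZr inner_sumr; congr (_ + _).
  by apply: eq_bigr => a _; rewrite inner_sumr; apply: eq_bigr => b _; rewrite innerZr.
have H i j : ip x (Z i j x) (T x) - \sum_k chris k i j x * ip x (W k x) (T x)
   = u x * ip x (W j x) (W i x)
     + \sum_a \sum_b (t a x * invmx (g x) a b)
         * (ip x (Z i j x) (E b x) - \sum_k chris k i j x * ip x (W k x) (E b x)).
  rewrite ipT cov_weingarten_normal // mulrNN -addrA; congr (_ + _).
  have -> : \sum_k chris k i j x * ip x (W k x) (T x)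
     = \sum_a \sum_b (t a x * invmx (g x) a b)
         * \sum_k chris k i j x * ip x (W k x) (E b x).
    transitivity (\sum_k \sum_a \sum_b (t a x * invmx (g x) a b)
         * (chris k i j x * ip x (W k x) (E b x))).
      apply: eq_bigr => k _; rewrite ipT weingarten_tangent // mulr0 add0r.
      rewrite mulr_sumr; apply: eq_bigr => a _; rewrite mulr_sumr.
      by apply: eq_bigr => b _; rewrite mulrCA.
    rewrite exchange_big; apply: eq_bigr => a _ /=.
    by rewrite exchange_big; apply: eq_bigr => b _ /=; rewrite mulr_sumr.
  rewrite -sumrB; apply: eq_bigr => a _; rewrite -sumrB; apply: eq_bigr => b _.
  by rewrite mulrBr.
rewrite (eq_tr2 _ H) tr2D tr2Z tr2_third_form // -addrA; congr (_ + _).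
rewrite tr2_sum.
under eq_bigr do rewrite tr2_sum.
under eq_bigr do under eq_bigr do rewrite tr2Z codazzi //.
rewrite {2}(T_decomp Ux) innerDl innerZl mulNr addrAC addNr add0r inner_suml.
apply: eq_bigr => a _; rewrite inner_suml; apply: eq_bigr => b _.
by rewrite innerZl.
Qed.

(** Here [c0] is n H. Once [dc] is replaced by f''/f - c^2, the last term adds c^2 u (u^2 - 1) to
    the one before it and turns the coefficient 2 into 3. *)
Lemma laplacian_angle x : U x ->
  laplacian g (fun y => u y) x
  = u x * \tr (S x *m S x) + inner (ricci G (psi x)) (T x) (N x)
    + u x * inner (ricci G (psi x)) (N x) (N x)
    + cc x * c0 * (1 + u x ^+ 2)
    + 2 * cc x * inner (invmx (g x) *m S x) (\row_i t i x) (\row_i t i x)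
    + cc x ^+ 2 * u x * (n%:R + 2 * (u x ^+ 2 - 1)) - dc x * u x * (u x ^+ 2 - 1).
Proof.
move=> Ux; rewrite /laplacian -/(metric_trace _ _).
rewrite (eq_tr2 _ (fun i j => hessian_angle i j Ux)).
rewrite tr2D tr2_rough_laplacian // !tr2D !tr2Z.
rewrite tr2_second_form // tr2_height // tr2_induced //.
have -> : tr2 x (fun i j => t j x * ip x (W i x) (T x))
    = tr2 x (fun i j => t i x * ip x (W j x) (T x)).
  rewrite /metric_trace exchange_big /=; apply: eq_bigr => i _; apply: eq_bigr => j _.
  by rewrite (gisym i j Ux).
rewrite tr2_height_weingarten //.
move: (inner _ _ _) (inner _ _ _) (inner _ _ _) (u x) (\tr _) => a b q v s.
move: (cc x) (dc x) => c d.
by ring.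
Qed.

End angle.

End hypersurface.

(** * Ricci symmetry and warped products *)

Lemma dmx_chr_sym (R : realType) k (V : set 'rV[R]_k)
    (G : 'rV[R]_k -> 'M[R]_k) l r y : smooth_metric V G -> V y ->
  (dmx r (chr G l) y)^T = dmx r (chr G l) y.
Proof.
move=> sG Vy; rewrite -dmx_tr; apply: near_eq_dmx.
apply: filterS (near_open (smetric_open sG) Vy) => z Vz.
by apply/matrixP => i j; rewrite mxE !chrE (christoffel_sym sG).
Qed.

Lemma bianchi (R : realType) k (V : set 'rV[R]_k)
    (G : 'rV[R]_k -> 'M[R]_k) y u v w : smooth_metric V G -> V y ->
  curv G y u v w + curv G y v w u + curv G y w u v = 0.
Proof.
move=> sG Vy; apply/rowP => l.
have sD a b c : inner (dirmx (chr G l) y a) b c = inner (dirmx (chr G l) y a) c b.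
  apply: inner_sym; rewrite unlock linear_sum; apply: eq_bigr => r _.
  by rewrite linearZ /= (dmx_chr_sym _ _ sG Vy).
have add (a b : 'rV[R]_k) : (a + b) 0 l = a 0 l + b 0 l by rewrite mxE.
rewrite !add mxE !curvE (sD u w v) (sD v u w) (sD w v u).
rewrite (gam_sym sG w v Vy) (gam_sym sG u w Vy) (gam_sym sG v u Vy).
set a1 := inner _ _ _; set a2 := inner _ _ _; set a3 := inner _ _ _.
set a4 := inner _ _ _; set a5 := inner _ _ _; set a6 := inner _ _ _.
by lra.
Qed.

(** R(u, v) is skew with respect to [G], so [M *m G y] is antisymmetric, and its product with the
    symmetric inverse metric has trace zero. *)
Lemma trace_curv (R : realType) k (V : set 'rV[R]_k)
    (G : 'rV[R]_k -> 'M[R]_k) y u v : smooth_metric V G -> V y ->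
  \sum_i curv G y u v (delta_mx 0 i) 0 i = 0.
Proof.
move=> sG Vy; pose M : 'M[R]_k := \matrix_i curv G y u v (delta_mx 0 i).
have ME w : w *m M = curv G y u v w.
  rewrite mulmx_sum_row {2}[w]row_sum_delta.
  elim: (index_enum _) => [|i r IH].
    by rewrite !big_nil -[X in curv _ _ _ _ X](scale0r w) curvZr scale0r.
  by rewrite !big_cons curvDr curvZr IH rowK.
transitivity (\tr M); first by apply: eq_bigr => i _; rewrite mxE.
have sGy := smetric_sym sG Vy.
have anti w z : inner (G y) (w *m M) z = - inner (G y) (z *m M) w.
  have := curv_metric_anti u v (w + z) sG Vy.
  rewrite -ME mulmxDl innerDl !innerDr !ME.
  rewrite !(curv_metric_anti _ _ _ sG Vy) add0r addr0.
  by move=> /eqP; rewrite addr_eq0 => /eqP.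
have antiM : (M *m G y)^T = - (M *m G y).
  apply/matrixP => i j; rewrite !mxE.
  have E a b : \sum_l M a l * G y l b = inner (G y) (delta_mx 0 a *m M) (delta_mx 0 b).
    by rewrite inner_deltar -rowE -row_mul !mxE.
  by rewrite !E anti.
have E0 : \tr M = - \tr M.
  rewrite -{1}(mulmxK (smetric_unit sG Vy) M) -mxtrace_tr trmx_mul antiM.
  rewrite mulmxN raddfN /= trmx_inv sGy mxtrace_mulC mulmxK //.
  exact: smetric_unit sG _ Vy.
by move: (\tr M) E0 => x E0; lra.
Qed.

(** By the Bianchi identity the antisymmetric part of the Ricci tensor is, up to a factor, the trace
    of R(v, w), which vanishes. *)
Lemma ricci_sym (R : realType) k (V : set 'rV[R]_k)
    (G : 'rV[R]_k -> 'M[R]_k) y v w : smooth_metric V G -> V y ->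
  inner (ricci G y) v w = inner (ricci G y) w v.
Proof.
move=> sG Vy; apply/eqP; rewrite -subr_eq0 !ricciE -sumrB; apply/eqP.
transitivity (- \sum_i curv G y v w (delta_mx 0 i) 0 i); last first.
  by rewrite (trace_curv _ _ sG Vy) oppr0.
rewrite -sumrN; apply: eq_bigr => i _.
have := bianchi (delta_mx 0 i) v w sG Vy.
rewrite (curv_anti _ _ w) => /rowP /(_ i); rewrite !mxE => E.
move: E; move: (curv _ _ _ _ _ _ _) (curv _ _ _ _ _ _ _).
by move: (curv _ _ _ _ _ _ _) => a b c E; lra.
Qed.

(** * Regularity of functions composed with projections *)

Section comp_linear.
Variables (R : realType) (V W : normedModType R) (L : {linear V -> W}).
Implicit Types (g : W -> R) (x v : V).

Let growth g x v :
  (fun h : R => h^-1 *: (((g \o L) \o shift x) (h *: v) - (g \o L) x))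
  = (fun h : R => h^-1 *: ((g \o shift (L x)) (h *: L v) - g (L x))).
Proof. by apply/funext => h /=; rewrite linearP. Qed.

Lemma derive_comp_linear g x v : 'D_v (g \o L) x = 'D_(L v) g (L x).
Proof. by rewrite /derive growth. Qed.

Lemma derivable_comp_linear g x v :
  derivable g (L x) (L v) -> derivable (g \o L) x v.
Proof. by rewrite /derivable growth. Qed.

End comp_linear.

Lemma Ck_rsubmx (R : realType) m n k (W : set 'rV[R]_n) (g : 'rV[R]_n -> R) :
  open W -> Ck k W g ->
  Ck k (@rsubmx R 1 m n @^-1` W) (g \o rsubmx).
Proof.
move=> oW; elim: k g => [|k IH] g [cg dg].
  split=> // x Wx; apply: continuous_comp; last exact: cg.
  exact: differentiable_continuous (differentiable_rsubmx _).
split.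
  move=> x Wx; apply: continuous_comp; last exact: cg.
  exact: differentiable_continuous (differentiable_rsubmx _).
have oW' : open (@rsubmx R 1 m n @^-1` W).
  apply: open_comp => // x _.
  exact: differentiable_continuous (differentiable_rsubmx _).
move=> i; case: (split_ordP i) => j ->.
- have Z : rsubmx (delta_mx 0 (lshift n j) : 'rV[R]_(m + n)) = 0.
    by apply/rowP => a; rewrite !mxE eq_rlshift andbF.
  split.
    move=> x Wx; apply: (@derivable_comp_linear _ _ _ (@rsubmx R 1 m n)).
    by rewrite /= Z; exact: derivable0.
  apply: eq_Ck (Ck_cst oW' k 0) => // x _.
  rewrite /partial (@derive_comp_linear _ _ _ (@rsubmx R 1 m n)) /= Z.
  by rewrite derive0.
- have Z : rsubmx (delta_mx 0 (rshift m j) : 'rV[R]_(m + n)) = delta_mx 0 j.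
    by apply/rowP => a; rewrite !mxE (inj_eq (@rshift_inj _ _)).
  have [dgj Cj] := dg j; split.
    move=> x Wx; apply: (@derivable_comp_linear _ _ _ (@rsubmx R 1 m n)).
    by rewrite /= Z; exact: dgj.
  apply: eq_Ck (IH _ Cj) => // x _.
  by rewrite /partial (@derive_comp_linear _ _ _ (@rsubmx R 1 m n)) /= Z.
Qed.

Lemma partial_comp1 (R : realType) m (phi : R -> R) (g : 'rV[R]_m -> R)
    (x : 'rV[R]_m) i :
  derivable phi (g x) 1 -> differentiable g x ->
  partial i (phi \o g) x = derive1 phi (g x) * partial i g x.
Proof.
move=> dphi dg; have dphi' : differentiable phi (g x) by exact/derivable1_diffP.
rewrite !partialE //; last exact: differentiable_comp.
by rewrite diff_comp //= deriv1E // mulrC.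
Qed.

Lemma Ck_comp_coord (R : realType) m k (I : set R) (phi : R -> R) (j : 'I_m) :
  open I -> (forall l t, I t -> derivable (derive1n l phi) t 1) ->
  Ck k [set x : 'rV[R]_m | I (x 0 j)] (fun x => phi (x 0 j)).
Proof.
move=> oI; elim: k phi => [|k IH] phi dphi.
  split=> // x Ix.
  apply: (@differentiable_continuous _ _ _ x (phi \o (fun y : 'rV[R]_m => y 0 j))).
  apply: differentiable_comp; first exact: differentiable_coord.
  by apply/derivable1_diffP; exact: (dphi 0%N).
have d (x : 'rV[R]_m) : I (x 0 j) ->
    differentiable (phi \o (fun y : 'rV[R]_m => y 0 j)) x.
  move=> Ix; apply: differentiable_comp; first exact: differentiable_coord.
  by apply/derivable1_diffP; exact: (dphi 0%N).
have oI' : open [set x : 'rV[R]_m | I (x 0 j)].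
  apply: (@open_comp _ _ (fun x : 'rV[R]_m => x 0 j)) => // x _.
  exact: differentiable_continuous (differentiable_coord _ _ _).
split; first by move=> x Ix; exact: differentiable_continuous (d x Ix).
move=> i; split; first by move=> x Ix; exact: diff_derivable (d x Ix).
have C : Ck k [set x : 'rV[R]_m | I (x 0 j)] (fun x => derive1 phi (x 0 j)).
  by apply: IH => l t It; rewrite -derive1Sn; exact: dphi.
apply: eq_Ck (CkM oI' C (Ck_cst oI' k (i == j)%:R)) => // x Ix.
rewrite -(partial_coord i j x) -partial_comp1 //; first exact: (dphi 0%N).
exact: differentiable_coord.
Qed.

Lemma derive1_div (R : realType) (p q : R -> R) t :
  derivable p t 1 -> derivable q t 1 -> q t != 0 ->
  derive1 (fun y => p y / q y) t
  = derive1 p t / q t - p t * derive1 q t / q t ^+ 2.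
Proof.
move=> dp dq q0; rewrite !derive1E.
transitivity ('D_1 (p * (fun y => (q y)^-1)) t) => //.
rewrite (deriveM dp (derivableV q0 dq)) (deriveV q0 dq) /GRing.scale /=.
by move: (q t) q0 (p t) ('D_1 p t) ('D_1 q t) => y y0 a d e; field.
Qed.

(** * Connection and curvature of the warped product in the direction of d_t *)

Section warped.
Variables (R : realType) (n : nat) (F : riemannianManifold R n) (I : set R).
Variables (f : R -> R) (b : chart_index (rm_atlas F)).
Hypothesis hf : is_warping I f.

Local Notation o0 := (lshift n (ord0 : 'I_1)).
Local Notation V := (chart_img (A := warped_atlas F I) b).
Local Notation W := (chart_img (A := rm_atlas F) b).
Local Notation G := (@warped_metric R n F I f b).
Local Notation T := (dt_field R n).
Local Notation gF := (@rm_metric R n F b).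

Lemma dt_fieldE : T = delta_mx 0 o0.
Proof.
apply/rowP => j; case: (split_ordP j) => i ->.
  by rewrite row_mxEl !mxE (ord1 i) !eqxx.
by rewrite row_mxEr !mxE eq_rlshift andbF.
Qed.

Lemma lsubmx00 (x : 'rV[R]_(1 + n)) : lsubmx x 0 0 = x 0 o0.
Proof. by rewrite mxE. Qed.

Lemma warped_imgE : V = [set x : 'rV[R]_(1 + n) | I (x 0 o0) /\ W (rsubmx x)].
Proof.
apply/seteqP; split=> [_ [[t p] [/= It dp] <-]|x [Ix [p dp px]]].
  split; first by rewrite row_mxEl mxE eqxx.
  by rewrite row_mxKr; exists p.
exists (x 0 o0, p); first by split.
rewrite /= px -[RHS]hsubmxK; congr row_mx.
by apply/rowP => i; rewrite (ord1 i) !mxE eqxx.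
Qed.

Let oW : open W.
Proof. exact: manifold_open_img (rm_is_manifold F) b. Qed.

Let oI : open I.
Proof. by case: hf. Qed.

Let oIx : open [set x : 'rV[R]_(1 + n) | I (x 0 o0)].
Proof.
apply: (@open_comp _ _ (fun x : 'rV[R]_(1 + n) => x 0 o0)) => // x _.
exact: differentiable_continuous (differentiable_coord _ _ _).
Qed.

Let oWx : open (@rsubmx R 1 1 n @^-1` W).
Proof.
apply: open_comp => // x _.
exact: differentiable_continuous (differentiable_rsubmx _).
Qed.

Lemma warped_img_open : open V.
Proof. by rewrite warped_imgE; exact: openI oIx oWx. Qed.

Let VI x : V x -> I (x 0 o0).
Proof. by rewrite warped_imgE => -[]. Qed.

Let VW x : V x -> W (rsubmx x).
Proof. by rewrite warped_imgE => -[]. Qed.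

Let f_gt0 x : V x -> 0 < f (x 0 o0).
Proof. by move=> /VI; case: hf => _ _ _ + _; apply. Qed.

Let df k t : I t -> derivable (derive1n k f) t 1.
Proof. by case: hf => _ _ _ _; apply. Qed.

Lemma warped00 x : G x o0 o0 = -1.
Proof. by rewrite /warped_metric block_mxEul !mxE eqxx. Qed.

Lemma warped0r x a : G x o0 (rshift 1 a) = 0.
Proof. by rewrite /warped_metric block_mxEur mxE. Qed.

Lemma warpedr0 x a : G x (rshift 1 a) o0 = 0.
Proof. by rewrite /warped_metric block_mxEdl mxE. Qed.

Lemma warpedrr x a c :
  G x (rshift 1 a) (rshift 1 c) = f (x 0 o0) ^+ 2 * gF (rsubmx x) a c.
Proof. by rewrite /warped_metric block_mxEdr mxE lsubmx00. Qed.

Let split0P (i : 'I_(1 + n)) : i = o0 \/ exists a, i = rshift 1 a.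
Proof.
case: (split_ordP i) => a ->; first by left; rewrite (ord1 a).
by right; exists a.
Qed.

Lemma posdef_unitmx (g : 'M[R]_n) :
  (forall v, v != 0 -> 0 < inner g v v) -> g \in unitmx.
Proof.
move=> pg; rewrite -row_free_unit -kermx_eq0; apply/negPn/negP => /rowV0Pn [v].
move=> /sub_kermxP vg v0; have := pg v v0.
by rewrite /inner vg mul0mx mxE ltxx.
Qed.

Lemma warped_unit x : V x -> G x \in unitmx.
Proof.
move=> Vx; rewrite unitmxE det_lblock det_mx11 !mxE eqxx.
rewrite unitrM unitrN unitr1 /= -unitmxE unitmxZ; last first.
  by rewrite unitfE expf_neq0 // gt_eqF // f_gt0.
apply: posdef_unitmx => v v0.
exact: metric_pos (rm_is_riemannian F) b _ _ (VW Vx) v0.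
Qed.

Lemma warped_smooth_metric : smooth_metric V G.
Proof.
split; first exact: warped_img_open.
- have oV := warped_img_open => i j.
  case: (split0P i) => [->|[a ->]]; case: (split0P j) => [->|[c ->]].
  + by apply: eq_smooth_on (smooth_on_cst (-1) oV) => // x _; rewrite warped00.
  + by apply: eq_smooth_on (smooth_on_cst 0 oV) => // x _; rewrite warped0r.
  + by apply: eq_smooth_on (smooth_on_cst 0 oV) => // x _; rewrite warpedr0.
  + move=> k.
    have Cf : Ck k V (fun x => f (x 0 o0)).
      apply: Ck_local => x Vx; exists [set x | I (x 0 o0)]; split; first exact: VI.
      exact: Ck_comp_coord.
    have Cg : Ck k V (fun x => gF (rsubmx x) a c).
      apply: Ck_local => x Vx; exists (@rsubmx R 1 1 n @^-1` W); split; first exact: VW.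
      apply: (@Ck_rsubmx _ 1 n k W (fun y => gF y a c)) => //.
      exact: metric_smooth (rm_is_riemannian F) b a c k.
    by apply: eq_Ck (CkM oV (CkM oV Cf Cf) Cg) => // x _; rewrite warpedrr.
- move=> x Vx; apply/matrixP => i j; rewrite mxE.
  case: (split0P i) => [->|[a ->]]; case: (split0P j) => [->|[c ->]] //.
  + by rewrite warped0r warpedr0.
  + by rewrite warped0r warpedr0.
  + rewrite !warpedrr; congr (_ * _).
    by rewrite -{1}(Defs.metric_sym (rm_is_riemannian F) (VW Vx)) mxE.
- exact: warped_unit.
Qed.

Let sG := warped_smooth_metric.

Lemma inner_dt x v : inner (G x) v T = - v 0 o0.
Proof.
rewrite dt_fieldE inner_deltar mxE (bigD1 o0) //= warped00 mulrN1.
rewrite big1 ?addr0 // => i; case: (split0P i) => [->|[a ->]]; first by rewrite eqxx.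
by rewrite warpedr0 mulr0.
Qed.

Definition log_deriv (t : R) : R := derive1 f t / f t.
Local Notation c := log_deriv.

Let partial_const i p q (x : 'rV[R]_(1 + n)) (c0 : R) :
  (forall y, G y p q = c0) -> partial i (fun y => G y p q) x = 0.
Proof. by move=> E; under eq_fun do rewrite E; exact: partial_cst. Qed.

Let partial0_rsub (g : 'rV[R]_n -> R) (x : 'rV[R]_(1 + n)) :
  partial o0 (g \o rsubmx) x = 0.
Proof.
rewrite /partial (@derive_comp_linear _ _ _ (@rsubmx R 1 1 n)) /=.
have -> : rsubmx (delta_mx 0 o0 : 'rV[R]_(1 + n)) = 0.
  by apply/rowP => a; rewrite !mxE eq_rlshift andbF.
exact: derive0.
Qed.

(** The fibre block scales like f^2, whence the factor 2 f'/f; the Kronecker term cancels the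
    constant entry -1, so that one formula covers all blocks. *)
Lemma partial0_warped p q x : V x ->
  partial o0 (fun y => G y p q) x
  = 2 * c (x 0 o0) * (G x p q + (p == o0)%:R * (q == o0)%:R).
Proof.
move=> Vx.
case: (split0P p) => [->|[a ->]]; case: (split0P q) => [->|[d ->]].
- by rewrite (partial_const _ _ warped00) warped00 eqxx mulr1 addNr mulr0.
- by rewrite (partial_const _ _ (warped0r ^~ d)) warped0r eq_rlshift mulr0 addr0 mulr0.
- by rewrite (partial_const _ _ (warpedr0 ^~ a)) warpedr0 eq_rlshift mul0r addr0 mulr0.
rewrite eq_rlshift mul0r addr0 warpedrr.
under eq_fun do rewrite warpedrr.
have dcoord : differentiable (fun y : 'rV[R]_(1 + n) => y 0 o0) x.
  exact: differentiable_coord.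
have dfx : differentiable (f \o (fun y : 'rV[R]_(1 + n) => y 0 o0)) x.
  apply: differentiable_comp => //; apply/derivable1_diffP.
  exact: (@df 0%N _ (VI Vx)).
have dgx : differentiable (fun y => gF (rsubmx y) a d) x.
  apply: (@differentiable_comp _ _ _ _ (@rsubmx R 1 1 n) (fun z => gF z a d)).
    exact: differentiable_rsubmx.
  apply: (smooth_on_differentiable oW) (VW Vx).
  exact: metric_smooth (rm_is_riemannian F) b a d.
have dff := differentiableM dfx dfx.
rewrite (@partialM _ _ _ _ _ _ dff dgx) (@partialM _ _ _ _ _ _ dfx dfx).
rewrite (partial0_rsub (fun z => gF z a d)) mulr0 addr0.
rewrite partial_comp1 //; last exact: (@df 0%N _ (VI Vx)).
rewrite partial_coord eqxx mulr1 /c /=.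
have := f_gt0 Vx; move: (f _) (derive1 _ _) (gF _ _ _) => y y' g y0.
by field; rewrite gt_eqF.
Qed.

Lemma invmx_warped0 x l : V x -> invmx (G x) l o0 = - (l == o0)%:R.
Proof.
move=> Vx; have E : G x *m (delta_mx o0 0 : 'cV[R]__) = - delta_mx o0 0.
  have Ed (i : 'I_(1 + n)) : (delta_mx o0 0 : 'cV[R]_(1 + n)) i 0 = (i == o0)%:R.
    by rewrite mxE eqxx andbT.
  apply/colP => i; rewrite -colE [LHS]mxE [RHS]mxE Ed.
  case: (split0P i) => [->|[a ->]]; first by rewrite warped00 ?eqxx.
  by rewrite warpedr0 ?eq_rlshift ?oppr0.
have : invmx (G x) *m (G x *m (delta_mx o0 0 : 'cV[R]__)) = delta_mx o0 0.
  by rewrite mulmxA mulVmx ?mul1mx // warped_unit.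
rewrite E mulmxN -colE => /colP /(_ l); rewrite !mxE ?eqxx ?andbT => <-.
by rewrite opprK.
Qed.

Lemma christoffel_warped0 x l p : V x ->
  christoffel G l p o0 x = c (x 0 o0) * ((l == p)%:R - (p == o0)%:R * (l == o0)%:R).
Proof.
move=> Vx; rewrite /christoffel.
have Z0 i h y : partial i (fun z => G z o0 h) y = 0.
  case: (split0P h) => [->|[a ->]].
    by apply: (@partial_const _ _ _ _ (-1)) => z; exact: warped00.
  by apply: (@partial_const _ _ _ _ 0) => z; exact: warped0r.
have Z1 i h y : partial i (fun z => G z h o0) y = 0.
  case: (split0P h) => [->|[a ->]].
    by apply: (@partial_const _ _ _ _ (-1)) => z; exact: warped00.
  by apply: (@partial_const _ _ _ _ 0) => z; exact: warpedr0.
under eq_bigr do rewrite Z0 Z1 subr0 add0r partial0_warped // mulrCA mulrDr.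
rewrite -mulr_sumr big_split /=.
have -> : \sum_h invmx (G x) l h * G x p h = (l == p)%:R.
  transitivity ((invmx (G x) *m G x) l p).
    by rewrite mxE; apply: eq_bigr => h _; rewrite (metric_entry_sym sG p h Vx).
  by rewrite mulVmx ?warped_unit // mxE.
rewrite (bigD1 o0) //= big1 ?addr0 => [|h /negbTE ho]; last by rewrite ho !mulr0.
rewrite ?eqxx mulr1 invmx_warped0 //.
by move: (_ == _) (_ == _) (_ == _) (c _) => [] [] [] d /=; lra.
Qed.

(** Since d_t has constant components, this is the formula for nabla_u d_t. *)
Lemma gam_warped0 x u : V x ->
  gam G x u T = c (x 0 o0) *: (u + inner (G x) u T *: T).
Proof.
move=> Vx; apply/rowP => l; rewrite gamE inner_dt dt_fieldE inner_deltar mxE.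
under eq_bigr do rewrite chrE christoffel_warped0 // mulrCA mulrBr.
rewrite -mulr_sumr sumrB !mxE eqxx /=; congr (_ * _).
rewrite (bigD1 l) //= eqxx mulr1 big1 ?addr0 => [|i /negbTE il]; last first.
  by rewrite eq_sym il mulr0.
rewrite (bigD1 o0) //= ?eqxx mul1r big1 ?addr0 ?mulNr // => i /negbTE ->.
by rewrite mul0r mulr0.
Qed.

Lemma derivable_log_deriv t : I t -> 0 < f t -> derivable c t 1.
Proof.
move=> It ft; apply: derivableM; first exact: (@df 1%N _ It).
by apply: derivableV; [rewrite gt_eqF|exact: (@df 0%N _ It)].
Qed.

Lemma derive1_log_deriv t : I t -> 0 < f t ->
  derive1 c t + c t ^+ 2 = derive1n 2 f t / f t.
Proof.
move=> It ft; have ft0 : f t != 0 by rewrite gt_eqF.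
have d0 := @df 0%N _ It; have d1 := @df 1%N _ It.
rewrite /c (derive1_div d1 d0 ft0) !derive1nS derive1n0.
by move: (f t) ft0 (derive1 f t) (derive1 _ t) => y y0 a d; field.
Qed.

Let differentiable_c x : V x -> differentiable (fun z : 'rV[R]_(1 + n) => c (z 0 o0)) x.
Proof.
move=> Vx; apply: (@differentiable_comp _ _ _ _ (fun z : 'rV[R]_(1 + n) => z 0 o0) c).
  exact: differentiable_coord.
apply/derivable1_diffP; apply: derivable_log_deriv; first exact: VI.
exact: f_gt0.
Qed.

Let partial_c i x : V x ->
  partial i (fun z => c (z 0 o0)) x = derive1 c (x 0 o0) * (i == o0)%:R.
Proof.
move=> Vx; rewrite -(partial_coord i o0 x) -(@partial_comp1 _ _ c (fun z => z 0 o0)) //.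
  by apply: derivable_log_deriv; [exact: VI|exact: f_gt0].
exact: differentiable_coord.
Qed.

(** Commutator formula for the constant field [T] with [psi = id]. Two uses of [gam_warped0] give
    the second covariant derivatives, and the symbols Gamma(e_i, e_j), which are never computed,
    cancel by symmetry. *)
Lemma curv_warped0 i j x : V x ->
  curv G x (delta_mx 0 i) (delta_mx 0 j) T
  = (derive1 c (x 0 o0) + c (x 0 o0) ^+ 2) *:
      ((i == o0)%:R *: delta_mx 0 j - (j == o0)%:R *: delta_mx 0 i).
Proof.
move=> Vx; have oV := warped_img_open.
pose A (z : 'rV[R]_(1 + n)) : 'rV[R]_(1 + n) := T.
pose w (j : 'I_(1 + n)) : 'rV[R]_(1 + n) := delta_mx 0 j - (j == o0)%:R *: T.
have psiV z : V z -> V (id z) by [].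
have spsi (l : 'I_(1 + n)) : smooth_on V (fun z : 'rV[R]_(1 + n) => id z 0 l).
  exact: smooth_on_coord.
have sA : smooth_field V A by move=> l; exact: smooth_on_cst.
have gamw a z : V z -> gam G z (delta_mx 0 a) T = c (z 0 o0) *: w a.
  move=> Vz; rewrite gam_warped0 // inner_dt mxE eqxx /= eq_sym.
  by rewrite scaleNr.
have covA a z : V z -> cov G id a A z = c (z 0 o0) *: w a.
  by move=> Vz; rewrite /cov dmx_cst add0r dmx_id gamw.
have H a d : cov G id a (cov G id d A) x
  = (derive1 c (x 0 o0) * (a == o0)%:R) *: w d
    + c (x 0 o0) *: (gam G x (delta_mx 0 a) (delta_mx 0 d)
                     - ((d == o0)%:R * c (x 0 o0)) *: w a).
  rewrite /cov -/(cov G id d A x) covA // dmx_id gamZr; congr (_ + _ *: _).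
    rewrite (@near_eq_dmx _ _ _ _ _ _ (fun z => c (z 0 o0) *: w d)); last first.
      by apply: filterS (near_open oV Vx) => z; exact: covA.
    apply/rowP => l; rewrite dmxE [RHS]mxE.
    under eq_fun do rewrite mxE.
    have dw : differentiable (fun _ : 'rV[R]_(1 + n) => w d 0 l) x.
      exact: differentiable_cst.
    rewrite (partialM a (differentiable_c Vx) dw) partial_c //.
    by rewrite partial_cst mulr0 addr0.
  rewrite /w gamDr -scaleNr gamZr gamw // -scalerA scaleNr.
  by [].
have := cov_comm oV warped_smooth_metric psiV spsi i j sA Vx.
rewrite !dmx_id => <-; rewrite !H (gam_sym warped_smooth_metric _ _ Vx).
(* [g0] stands for Gamma(e_i, e_j), [g1] for e_i, [g2] for e_j, [g3] for d_t; [e1] and [e2] are the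
   Kronecker symbols of i and j, [e3] is c' and [e4] is c. *)
have key (g0 g1 g2 g3 : 'rV[R]_(1 + n)) (e1 e2 e3 e4 : R) :
    (e3 * e1) *: (g2 - e2 *: g3) + e4 *: (g0 - (e2 * e4) *: (g1 - e1 *: g3))
    - ((e3 * e2) *: (g1 - e1 *: g3) + e4 *: (g0 - (e1 * e4) *: (g2 - e2 *: g3)))
    = (e3 + e4 ^+ 2) *: (e1 *: g2 - e2 *: g1).
  by apply/rowP => l; rewrite !mxE; ring.
exact: key.
Qed.

(** In the trace of [curv_warped0] the time direction contributes nothing and the n fibre directions
    contribute equally: d_t is an eigenvector of the Ricci tensor. *)
Lemma ricci_warped0 x v : V x ->
  inner (ricci G x) v T
  = n%:R * (derive1n 2 f (x 0 o0) / f (x 0 o0)) * inner (G x) v T.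
Proof.
move=> Vx; rewrite -derive1_log_deriv; [|exact: VI|exact: f_gt0].
set K := _ + _; rewrite inner_dt.
have base j : inner (ricci G x) (delta_mx 0 j) T = - (n%:R * K * (j == o0)%:R).
  rewrite ricciE big_split_ord /= big_ord1.
  under eq_bigr do rewrite curv_warped0 //.
  rewrite curv_warped0 // -/K.
  have E i : (K *: ((i == o0)%:R *: delta_mx 0 j - (j == o0)%:R *: delta_mx 0 i)
      : 'rV[R]_(1 + n)) 0 i
    = K * ((i == o0)%:R * (i == j)%:R - (j == o0)%:R).
    by rewrite !mxE !eqxx /= mulr1.
  rewrite E; under eq_bigr do rewrite E eq_rlshift mul0r sub0r.
  rewrite sumr_const card_ord eqxx mul1r (eq_sym o0 j) subrr mulr0 add0r.
  by rewrite -[LHS]mulr_natl mulrN mulrN mulrA.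
rewrite {1}[v]row_sum_delta inner_suml.
under eq_bigr do rewrite innerZl base mulrN.
rewrite sumrN (bigD1 o0) //= ?eqxx mulr1 big1 ?addr0 => [|i /negbTE ->].
  by rewrite mulrC mulrN.
by rewrite !mulr0.
Qed.

End warped.

(** * Algebraic inequalities *)

Lemma mulmx_congruence (R : realType) m n p (Q : 'M[R]_(m, n)) (L : 'M[R]_(n, p)) g :
  (Q *m L) *m g *m (Q *m L)^T = Q *m (L *m g *m L^T) *m Q^T.
Proof. by rewrite trmx_mul !mulmxA. Qed.

(** Induction on the size: one elimination step [L] splits off the first entry and leaves the Schur
    complement [s]. The rows of [P] form a [g]-orthonormal basis. *)
Lemma posdef_diagonalize (R : realType) n (g : 'M[R]_n) :
  g^T = g -> (forall v, v != 0 -> 0 < inner g v v) ->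
  exists P : 'M[R]_n, P *m g *m P^T = 1%:M.
Proof.
elim: n g => [|n IH] g sg pg; first by exists 1%:M; apply/matrixP => -[].
rewrite -[n.+1]/(1 + n)%N in g sg pg *.
rewrite -(submxK g) in sg pg *.
set a := ulsubmx g in sg pg *; set b := ursubmx g in sg pg *.
set d := drsubmx g in sg pg *.
have [_ bE _ dE] : [/\ a^T = a, b = (dlsubmx g)^T, b^T = dlsubmx g & d^T = d].
  move: sg; rewrite tr_block_mx => /eq_block_mx [E1 E2 E3 E4].
  by split; rewrite // -E2 trmxK.
have -> : dlsubmx g = b^T by rewrite bE trmxK.
rewrite (_ : dlsubmx g = b^T) in pg; last by rewrite bE trmxK.
have [a0 aE] : 0 < a 0 0 /\ a = (a 0 0)%:M.
  split; last exact: mx11_scalar.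
  have := pg (row_mx 1%:M 0); rewrite /inner mul_row_block tr_row_mx mul_row_col.
  rewrite trmx0 !mulmx0 !mul0mx !addr0 mul1mx trmx1 mulmx1; apply.
  apply/negP => /eqP /rowP /(_ (lshift n ord0)); rewrite row_mxEl !mxE eqxx /=.
  by move/eqP; rewrite oner_eq0.
set al := a 0 0 in a0 aE.
have al0 : al != 0 by rewrite gt_eqF.
pose L : 'M[R]_(1 + n) := block_mx 1%:M 0 (- al^-1 *: b^T) 1%:M.
pose s := d - al^-1 *: (b^T *m b).
have LgL : L *m block_mx a b b^T d *m L^T = block_mx a 0 0 s.
  rewrite /L tr_block_mx !mulmx_block !trmx1 !trmx0 !mul0mx !mulmx0 !mul1mx !mulmx1.
  rewrite !addr0 aE linearZ /= trmxK -!scalemxAl -!scalemxAr.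
  rewrite mul_scalar_mx scalar_mxC mul_scalar_mx !scalerA mulNr mulVf //.
  rewrite !scaleN1r !addNr mul0mx scaler0 add0r.
  by rewrite /s scaleNr [- _ + d]addrC.
have [P PsP] : exists P : 'M[R]_n, P *m s *m P^T = 1%:M.
  apply: IH => [|v v0].
    by rewrite /s linearB linearZ /= trmx_mul trmxK dE.
  (* The Schur complement is the original form evaluated on the vectors [row_mx 0 v *m L], hence
     again positive definite. *)
  have E : inner s v v = inner (block_mx a b b^T d) (row_mx 0 v *m L) (row_mx 0 v *m L).
    rewrite /inner mulmx_congruence LgL.
    by rewrite tr_row_mx mul_row_block !mul0mx !mulmx0 !add0r mul_row_col mul0mx add0r.
  rewrite E; apply: pg; apply: contra v0 => /eqP.
  rewrite /L mul_row_block !mul0mx !add0r mulmx1 => /eqP; rewrite row_mx_eq0.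
  by case/andP.
exists (block_mx ((Num.sqrt al)^-1)%:M 0 0 P *m L).
rewrite mulmx_congruence LgL.
rewrite tr_block_mx !mulmx_block !trmx0 !mul0mx !mulmx0 !addr0 !add0r PsP.
rewrite !mul0mx aE -!scalar_mxM tr_scalar_mx -scalar_mxM scalar_mx_block.
congr block_mx; congr (_%:M).
have sq0 : Num.sqrt al != 0 by rewrite gt_eqF // sqrtr_gt0.
by rewrite -{2}(sqr_sqrtr (ltW a0)) expr2; field.
Qed.

(** The symmetry of [S *m g] says that [S] is self-adjoint for [g]. In an orthonormal basis it
    becomes a symmetric matrix [S'], and the trace of its square is a sum of squares. *)
Lemma trace_sq_ge0 (R : realType) n (g S : 'M[R]_n) :
  g^T = g -> (forall v, v != 0 -> 0 < inner g v v) ->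
  (S *m g)^T = S *m g -> 0 <= \tr (S *m S).
Proof.
move=> sg pg sS; have [P PgP] := posdef_diagonalize sg pg.
have uP : P \in unitmx.
  by have [] := mulmx1_unit (etrans (mulmxA _ _ _) PgP).
pose S' := P *m S *m invmx P.
have uPT : P^T \in unitmx by rewrite unitmx_tr.
have gE : g = invmx P *m (invmx P)^T.
  have /(canRL (mulmxK uPT)) /(canRL (mulKmx uP)) -> := PgP.
  by rewrite mul1mx trmx_inv.
have sS' : S'^T = S'.
  rewrite /S' !trmx_mul trmx_inv.
  have E : P *m (S *m g)^T *m P^T = P *m (S *m g) *m P^T by rewrite sS.
  move: E; rewrite trmx_mul sg {1}gE {1}gE !mulmxA mulmxV // mul1mx => E.
  rewrite -trmx_inv E -[RHS]mulmx1 -!mulmxA; congr (_ *m (_ *m (_ *m _))).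
  by rewrite trmx_inv mulVmx.
have -> : \tr (S *m S) = \tr (S' *m S'^T).
  rewrite sS' /S' mulmxA -(mulmxA _ (invmx P) (P *m S)) (mulmxA (invmx P)) mulVmx //.
  by rewrite mul1mx [RHS]mxtrace_mulC !mulmxA mulVmx // mul1mx.
rewrite /mxtrace; apply: sumr_ge0 => i _; rewrite mxE; apply: sumr_ge0 => j _.
by rewrite [X in _ * X]mxE -expr2 sqr_ge0.
Qed.

(** [trace_sq_ge0] applied to the traceless part of [S]. *)
Lemma trace_cauchy_schwarz (R : realType) n (g S : 'M[R]_n) :
  g^T = g -> (forall v, v != 0 -> 0 < inner g v v) ->
  (S *m g)^T = S *m g -> \tr S ^+ 2 <= n%:R * \tr (S *m S).
Proof.
move=> sg pg sS; case: n => [|n] in g S sg pg sS *.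
  by rewrite /mxtrace !big_ord0 expr0n mul0r.
pose a := \tr S / n.+1%:R.
have n0 : (n.+1%:R : R) != 0 by rewrite pnatr_eq0.
have := @trace_sq_ge0 _ _ g (S - a%:M) sg pg.
rewrite mulmxBl linearB /= sS mul_scalar_mx linearZ /= sg => /(_ erefl).
rewrite mulmxBr mulmxBl !linearB /= mul_scalar_mx mulmxBl.
rewrite mul_scalar_mx !linearB /= mul_mx_scalar !linearZ /= mxtrace_scalar.
have n1 : 0 < (n.+1%:R : R) by rewrite ltr0n.
rewrite /a; move: (\tr S) (\tr (S *m S)) => s q H.
have {}H : 0 <= q + s / n.+1%:R * - s
    + (s / n.+1%:R * - s + s / n.+1%:R * - - (s / n.+1%:R *+ n.+1)) := H.
have := mulr_ge0 (ltW n1) H; rewrite -(mulr_natr (s / n.+1%:R)) opprK.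
move: (n.+1%:R : R) n0.
move=> y y0.
have -> : y * (q + s / y * - s + (s / y * - s + s / y * (s / y * y)))
    = y * q - s ^+ 2 by field.
by rewrite subr_ge0.
Qed.

(* The Cauchy-Schwarz inequality for S + k t^T t g^-1. *)
Lemma weingarten_bound (R : realType) n (g S : 'M[R]_n) (t : 'rV[R]_n) (k : R) :
  g^T = g -> (forall v, v != 0 -> 0 < inner g v v) -> g \in unitmx ->
  (S *m g)^T = S *m g ->
  (\tr S + k * inner (invmx g) t t) ^+ 2
  <= n%:R * (\tr (S *m S) + 2 * k * inner (invmx g *m S) t t
             + (k * inner (invmx g) t t) ^+ 2).
Proof.
move=> sg pg ug sS; pose B := t^T *m t *m invmx g.
have trB M : \tr (M *m B) = inner (invmx g *m M) t t.
  rewrite /B /inner !mulmxA mxtrace_mulC !mulmxA mxtrace_mulC !mulmxA.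
  by rewrite /mxtrace big_ord1.
have := @trace_cauchy_schwarz _ _ g (S + k *: B) sg pg.
rewrite mulmxDl linearD /= sS -scalemxAl linearZ /= -[B *m g]mulmxA mulVmx // mulmx1.
rewrite trmx_mul trmxK => /(_ erefl).
rewrite !mulmxDl !mulmxDr -!scalemxAl -!scalemxAr !linearD !linearZ /=.
rewrite trB [\tr (B *m S)]mxtrace_mulC trB trB.
have -> : \tr B = inner (invmx g) t t by rewrite -(mul1mx B) trB mulmx1.
have -> : inner (invmx g *m B) t t = inner (invmx g) t t ^+ 2.
  rewrite /B /inner !mulmxA -(mulmxA _ t (invmx g)) -(mulmxA _ (t *m _)).
  rewrite [X in X *m _]mx11_scalar [X in _ *m X]mx11_scalar -scalar_mxM.
  by rewrite mxE eqxx expr2.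
move: (\tr S) (\tr _) (inner _ _ _) (inner _ _ _) => a q e d H.
apply: le_trans H _; rewrite le_eqVlt; apply/orP; left; apply/eqP.
by congr (_ * _); ring.
Qed.

Section polynomial.
Variable R : realType.

(* After division by c^2 this is a quadratic polynomial in x = - H / c which
   decreases for x <= 2 / sqrt nr; at x = 2 / sqrt nr it splits as a square plus
   u^2 - 1 times a positive polynomial. *)
Lemma angle_poly_gt0 (nr H c u : R) :
  5 <= nr -> 1 <= u -> c != 0 -> H ^+ 2 <= 4 / nr * c ^+ 2 ->
  0 < (u * (nr * H) + c * (u ^+ 2 - 1)) ^+ 2 / nr - (c * (u ^+ 2 - 1)) ^+ 2
      + c * (nr * H) * u * (1 + u ^+ 2)
      + c ^+ 2 * u ^+ 2 * (nr + 3 * (u ^+ 2 - 1)).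
Proof.
move=> n5 u1 c0 Hc.
pose m := Num.sqrt nr.
have mm : nr = m ^+ 2 by rewrite sqr_sqrtr //; lra.
have m0 : 0 < m by rewrite sqrtr_gt0; lra.
have m2 : 5 <= m ^+ 2 by rewrite -mm.
pose x := - H / c; pose x0 := 2 / m.
have HE : H = - x * c by rewrite /x; field.
have mN : m != 0 by rewrite gt_eqF.
have c2 : 0 < c ^+ 2 by rewrite exprn_even_gt0.
have x0p : 0 < x0 by rewrite divr_gt0.
have xx0 : x <= x0.
  have : x ^+ 2 <= x0 ^+ 2.
    rewrite /x /x0 !expr_div_n sqrrN ler_pdivrMr // -mm.
    by rewrite (_ : 2 ^+ 2 = 4) //; ring.
  move=> xx; rewrite leNgt; apply/negP => lt.
  have : x0 ^+ 2 < x ^+ 2 by rewrite ltr_pXn2r // nnegrE; lra.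
  by rewrite ltNge xx.
pose Q y := nr * y ^+ 2 * u ^+ 2 - y * u * ((nr + 2) * u ^+ 2 + nr - 2)
  + ((2 + nr^-1) * u ^+ 4 + (nr - 1 - 2 * nr^-1) * u ^+ 2 - 1 + nr^-1).
have nN : nr != 0 by rewrite mm expf_neq0.
rewrite (_ : _ + _ = c ^+ 2 * Q x); last by rewrite /Q HE; field.
apply: mulr_gt0 => //.
have Q0 : 0 < Q x0.
  have -> : Q x0 = (u ^+ 2 - m * u + 1) ^+ 2
     + (u ^+ 2 - 1) * ((1 + nr^-1) * u ^+ 2 - 4 / m * u + 2 - nr^-1).
    by rewrite /Q /x0 mm; field.
  have P2 : 0 < (1 + nr^-1) * u ^+ 2 - 4 / m * u + 2 - nr^-1.
    have -> : (1 + nr^-1) * u ^+ 2 - 4 / m * u + 2 - nr^-1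
      = (u - 2 / m) ^+ 2 + (u ^+ 2 / nr + 2 - 5 / nr).
      by rewrite mm; field.
    have h1 : 0 <= (u - 2 / m) ^+ 2 by exact: sqr_ge0.
    have h2 : 5 / nr <= 1 by rewrite ler_pdivrMr ?mul1r //; lra.
    have h3 : 0 <= u ^+ 2 / nr by rewrite divr_ge0 ?sqr_ge0 //; lra.
    by lra.
  (* At u = 1 the second summand vanishes and only (2 - m)^2 is left, which is positive because m^2
     >= 5 excludes m = 2. *)
  have [->|un1] := eqVneq u 1.
    rewrite expr1n subrr mul0r addr0 exprn_even_gt0 //=.
    apply/negP => /eqP E; have m2' : m = 2 by lra.
    by move: m2; rewrite m2'; lra.
  have u1' : 1 < u by rewrite lt_neqAle eq_sym un1.
  apply: ltr_wpDl; first exact: sqr_ge0.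
  by apply: mulr_gt0 => //; nra.
apply: lt_le_trans Q0 _; rewrite -subr_ge0.
have -> : Q x - Q x0 = (x0 - x) * (u * ((nr + 2) * u ^+ 2 + nr - 2 - nr * u * (x + x0))).
  by rewrite /Q; ring.
apply: mulr_ge0; first by rewrite subr_ge0.
apply: mulr_ge0; first by lra.
have b1 : nr * u * (x + x0) <= nr * u * (x0 + x0).
  by apply: ler_wpM2l; [apply: mulr_ge0; lra|rewrite lerD2r].
have b2 : nr * u * (x0 + x0) = 4 * m * u by rewrite /x0 mm; field.
suff : 0 <= (nr + 2) * u ^+ 2 + nr - 2 - 4 * m * u by lra.
(* Completing the square in u; the remainder nr^2 - 4 nr - 4 is 1 at nr = 5 and increases from
   there. *)
have E : (nr + 2) * ((nr + 2) * u ^+ 2 + nr - 2 - 4 * m * u)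
   = ((nr + 2) * u - 2 * m) ^+ 2 + (nr ^+ 2 - 4 - 4 * nr).
  by rewrite mm; ring.
have n2 : 0 < nr + 2 by lra.
rewrite -(pmulr_rge0 _ n2) E; apply: addr_ge0; first exact: sqr_ge0.
by nra.
Qed.

(** The limit of e to 0. If a < 0, the choice e = -a / (2 (r + 1)) turns a + e r into a positive
    multiple of a; the 1 added to r avoids a division by zero. *)
Lemma ge0_of_perturb (a r : R) :
  0 <= r -> (forall e, 0 < e -> 0 <= a + e * r) -> 0 <= a.
Proof.
move=> r0 H; rewrite leNgt; apply/negP => a0.
have r1 : 0 < 2 * (r + 1) by lra.
have e0 : 0 < - a / (2 * (r + 1)) by rewrite divr_gt0 //; lra.
have := H _ e0.
have -> : a + - a / (2 * (r + 1)) * r = a * ((r + 2) / (2 * (r + 1))).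
  by field; rewrite gt_eqF //; lra.
have : 0 < (r + 2) / (2 * (r + 1)) by rewrite divr_gt0 //; lra.
by move=> p; rewrite pmulr_lge0 //; lra.
Qed.

End polynomial.

(** * The main theorem *)

(** [s] stands for tr(S^2), [q] for <S grad tau, grad tau>, [r1] and [r2] for the Ricci terms, [ff]
    for f''/f and [dc] for (f'/f)'. The last hypothesis is [weingarten_bound] with weight c/u.
    Multiplication by u > 0 clears the quotients and reduces the claim to [angle_poly_gt0] plus
    nonnegative terms. *)
Lemma angle_laplacian_bound (R : realType) (nr H c u s q r1 r2 ff dc : R) :
  5 <= nr -> 1 <= u -> c != 0 -> H ^+ 2 <= 4 / nr * c ^+ 2 ->
  0 <= r1 + r2 -> ff <= 0 -> dc = ff - c ^+ 2 ->
  (nr * H + c / u * (u ^+ 2 - 1)) ^+ 2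
    <= nr * (s + 2 * (c / u) * q + (c / u * (u ^+ 2 - 1)) ^+ 2) ->
  0 < u * s + r1 + r2 + c * (nr * H) * (1 + u ^+ 2) + 2 * c * q
      + c ^+ 2 * u * (nr + 2 * (u ^+ 2 - 1)) - dc * u * (u ^+ 2 - 1).
Proof.
move=> n5 u1 c0 Hc ric0 ff0 -> bd.
have u0 : 0 < u by lra.
have n0 : 0 < nr by lra.
have s0 : 0 <= u ^+ 2 - 1 by nra.
rewrite -(pmulr_rgt0 _ u0).
apply: lt_le_trans (angle_poly_gt0 n5 u1 c0 Hc) _.
have bd' : (u * (nr * H) + c * (u ^+ 2 - 1)) ^+ 2 / nr - (c * (u ^+ 2 - 1)) ^+ 2
   <= u ^+ 2 * s + 2 * c * u * q.
  rewrite lerBlDr ler_pdivrMr //.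
  have -> : (u * (nr * H) + c * (u ^+ 2 - 1)) ^+ 2
     = u ^+ 2 * (nr * H + c / u * (u ^+ 2 - 1)) ^+ 2 by field; rewrite gt_eqF.
  have -> : (u ^+ 2 * s + 2 * c * u * q + (c * (u ^+ 2 - 1)) ^+ 2) * nr
     = u ^+ 2 * (nr * (s + 2 * (c / u) * q + (c / u * (u ^+ 2 - 1)) ^+ 2)).
    by field; rewrite gt_eqF.
  by rewrite ler_pM2l // exprn_gt0.
have h1 : 0 <= u * (r1 + r2) by apply: mulr_ge0 => //; lra.
have h2 : ff * u ^+ 2 * (u ^+ 2 - 1) <= 0.
  by rewrite -mulrA mulr_le0_ge0 // mulr_ge0 // sqr_ge0.
rewrite -subr_ge0.
set d := _ - _; have -> : d =
  (u ^+ 2 * s + 2 * c * u * q - ((u * (nr * H) + c * (u ^+ 2 - 1)) ^+ 2 / nr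
     - (c * (u ^+ 2 - 1)) ^+ 2)) + u * (r1 + r2) - ff * u ^+ 2 * (u ^+ 2 - 1).
  by rewrite /d; ring.
by lra.
Qed.

(** * Consequences of the timelike convergence condition *)

Section ricci_bound.
Variables (R : realType) (n : nat) (F : riemannianManifold R n) (I : set R).
Variables (f : R -> R) (b : chart_index (rm_atlas F)).
Hypotheses (hf : is_warping I f) (hTCC : timelike_convergence F I f).
Hypothesis n0 : (0 < n)%N.

Local Notation o0 := (lshift n (ord0 : 'I_1)).
Local Notation V := (chart_img (A := warped_atlas F I) b).
Local Notation G := (@warped_metric R n F I f b).
Local Notation T := (dt_field R n).
Local Notation Ric x := (inner (ricci G x)).

Lemma dt0 : T 0 o0 = 1.
Proof. by rewrite dt_fieldE mxE !eqxx. Qed.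

Lemma inner_dt_dt x : inner (G x) T T = -1.
Proof. by rewrite inner_dt dt0. Qed.

(** The convergence condition at z = d_t, where Ric(d_t, d_t) = -n f''/f. *)
Lemma warping_concave x : V x -> derive1n 2 f (x 0 o0) / f (x 0 o0) <= 0.
Proof.
move=> Vx; have := hTCC (b := b) (z := T) Vx.
rewrite inner_dt_dt ricci_warped0 // inner_dt_dt mulrN1 oppr_ge0 ltrN10 => /(_ isT).
by rewrite pmulr_rle0 // ltr0n.
Qed.

(* For W = N + u T, which is orthogonal to T, the vectors W + r T are timelike
   for r^2 > <W, W> = u^2 - 1; let r^2 tend to u^2 - 1. *)
Lemma ricci_normal_ge0 x N : V x -> inner (G x) N N = -1 ->
  1 <= inner (G x) N T -> 0 <= Ric x T N + inner (G x) N T * Ric x N N.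
Proof.
move=> Vx NN; set u := inner (G x) N T => u1.
have sG := warped_smooth_metric b hf.
have sy := inner_sym _ _ (smetric_sym sG Vx).
have rs v w := ricci_sym v w sG Vx.
set k := n%:R * (derive1n 2 f (x 0 o0) / f (x 0 o0)).
have RT v : Ric x v T = k * inner (G x) v T by exact: ricci_warped0.
have k0 : k <= 0 by rewrite pmulr_rle0 ?ltr0n //; exact: warping_concave.
pose W := N + u *: T.
have WT : inner (G x) W T = 0.
  by rewrite /W innerDl innerZl inner_dt_dt -/u mulrN1 subrr.
have WW : inner (G x) W W = u ^+ 2 - 1.
  rewrite {2}/W innerDr innerZr WT mulr0 addr0 /W innerDl innerZl NN.
  by rewrite sy -/u; ring.
have NE : N = W + - u *: T by rewrite /W scaleNr addrK.
clearbody W.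
have H r : u ^+ 2 - 1 < r ^+ 2 -> 0 <= Ric x W W + r ^+ 2 * - k.
  move=> ur; have := hTCC (b := b) (z := W + r *: T) Vx.
  rewrite !innerDl !innerDr !innerZl !innerZr !(sy T W) WT inner_dt_dt WW.
  rewrite !(rs T W) !RT WT inner_dt_dt.
  rewrite (_ : _ + _ < 0); last by lra.
  by move=> /(_ isT); rewrite !mulr0 !mulrN1 addr0 add0r mulrA expr2.
have RN : Ric x N N = Ric x W W + u ^+ 2 * - k.
  rewrite {1 2}NE !innerDl !innerDr !innerZl !innerZr !(rs T W) !RT WT inner_dt_dt.
  by ring.
(* The sum is u (k + Ric(N, N)). The second factor is the Ricci curvature of W + r T for r^2 = u^2 -
   1, a vector with <., .> = 0 that is a limit of timelike vectors. *)
rewrite (rs T N) RT -/u mulrC -mulrDr; apply: mulr_ge0; first by lra.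
rewrite RN; suff : 0 <= Ric x W W + (u ^+ 2 - 1) * - k by lra.
apply: (@ge0_of_perturb _ _ (- k)); first by lra.
move=> e e0; have p0 : 0 <= u ^+ 2 - 1 + e by nra.
have := H (Num.sqrt (u ^+ 2 - 1 + e)); rewrite sqr_sqrtr // => /(_ _).
by rewrite (mulrDl (u ^+ 2 - 1)) addrA; apply; rewrite ltrDl.
Qed.

End ricci_bound.

Section laplacian_local.
Variables (R : realType) (m : nat) (U : set 'rV[R]_m) (g : 'rV[R]_m -> 'M[R]_m).
Hypothesis oU : open U.

Lemma laplacian_cst (K : R) x : laplacian g (fun=> K) x = 0.
Proof.
rewrite /laplacian big1 // => i _; rewrite big1 // => j _.
have P k : partial k (fun=> K) = (fun=> 0).
  by apply/funext => y; exact: partial_cst.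
rewrite P partial_cst big1 ?subr0 ?mulr0 // => k _.
by rewrite partial_cst mulr0.
Qed.

Lemma laplacian_affine (K : R) (f h : 'rV[R]_m -> R) x :
  smooth_on U f -> (forall y, U y -> h y = K - f y) -> U x ->
  laplacian g h x = - laplacian g f x.
Proof.
move=> sf hE Ux.
have dpf j y : U y -> differentiable (partial j f) y.
  by apply: (smooth_on_differentiable oU); exact: smooth_on_partial.
have P j y : U y -> partial j h y = - partial j f y.
  move=> Uy; rewrite (@near_eq_partial _ _ j _ (fun y => K - f y)); last first.
    by apply: filterS (near_open oU Uy) => z; exact: hE.
  have dK : differentiable (fun _ : 'rV[R]_m => K) y by exact: differentiable_cst.
  by rewrite (partialB j dK (smooth_on_differentiable oU sf Uy)) partial_cst sub0r.
have PP i j : partial i (partial j h) x = - partial i (partial j f) x.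
  rewrite (@near_eq_partial _ _ i _ (fun y => - partial j f y)); last first.
    by apply: filterS (near_open oU Ux) => z; exact: P.
  by rewrite partialN //; exact: dpf.
rewrite /laplacian -sumrN; apply: eq_bigr => i _; rewrite -sumrN.
apply: eq_bigr => j _; rewrite PP -mulrN opprB addrC; congr (_ * (_ - _)).
by rewrite -sumrN; apply: eq_bigr => k _; rewrite P // mulrN opprK.
Qed.

End laplacian_local.

Lemma smooth_on_sub (R : realType) m (U U' : set 'rV[R]_m) f :
  U' `<=` U -> smooth_on U f -> smooth_on U' f.
Proof. by move=> sU sf k; apply: Ck_local => x /sU Ux; exists U. Qed.

Lemma local_domE (R : realType) (T S : topologicalType) m k
    (A : atlas R T m) (B : atlas R S k) (psi : T -> S)
    (a : chart_index A) (b : chart_index B) :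
  is_manifold A ->
  local_dom psi a b
  = [set x | chart_img a x /\ chart_dom b (psi (chart_inv a x))].
Proof.
move=> mA; apply/seteqP; split=> [_ [p [ap bp] <-]|x [[p ap <-]]].
  by split; [exists p|rewrite (manifold_chartK mA)].
by rewrite (manifold_chartK mA) // => bp; exists p.
Qed.

Lemma local_dom_open (R : realType) (T S : topologicalType) m k
    (A : atlas R T m) (B : atlas R S k) (psi : T -> S)
    (a : chart_index A) (b : chart_index B) :
  is_manifold A -> continuous psi -> open (chart_dom b) ->
  open (local_dom psi a b).
Proof.
move=> mA cpsi ob; rewrite local_domE // openE => x [ax bx].
have ia : nbhs x (chart_img a).
  by apply: open_nbhs_nbhs; split=> //; exact: manifold_open_img mA a.
have cx : {for x, continuous (psi \o chart_inv a)}.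
  by apply: continuous_comp; [exact: manifold_inv_continuous mA _ _ ax|exact: cpsi].
have ib : nbhs x ((psi \o chart_inv a) @^-1` chart_dom b).
  by apply: cx; exact: open_nbhs_nbhs.
exact: filterI ia ib.
Qed.

Lemma inner_congruence (R : realType) m k (G : 'M[R]_k) (J : 'M[R]_(m, k)) u v :
  inner (J *m G *m J^T) u v = inner G (u *m J) (v *m J).
Proof. by rewrite /inner trmx_mul !mulmxA. Qed.

(** * The angle of the hypersurface in one pair of charts *)

Section hypersurface_local.
Variables (R : realType) (n : nat) (F : riemannianManifold R n) (I : set R).
Variables (f : R -> R) (X : spacelikeHypersurface F I f).
Variables (a : chart_index (rm_atlas X)) (b : chart_index (rm_atlas F)) (H : R).
Hypotheses (hf : is_warping I f) (hTCC : timelike_convergence F I f).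
Hypotheses (n5 : (5 <= n)%N) (cmc : constant_mean_curvature X H) (H0 : H != 0).
Hypothesis bound : forall p : X,
  H ^+ 2 <= 4 / n%:R * (derive1 f (tau p) ^+ 2 / f (tau p) ^+ 2).

Local Notation o0 := (lshift n (ord0 : 'I_1)).
Local Notation psi := (local_rep (B := warped_atlas F I) (@hs_map R n F I f X) a b).
Local Notation U := (local_dom (B := warped_atlas F I) (@hs_map R n F I f X) a b).
Local Notation V := (chart_img (A := warped_atlas F I) b).
Local Notation G := (@warped_metric R n F I f b).
Local Notation T := (dt_field R n).
Local Notation g := (@rm_metric R n X a).
Local Notation N := (fun x => hs_normal (s := X) (chart_inv a x) b).
Local Notation u x := (inner (G (psi x)) (N x) T).

Let mX := rm_is_manifold X.

Let oU : open U.
Proof.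
apply: (@local_dom_open R X (R * F)%type n (1 + n) (rm_atlas X) (warped_atlas F I)
  (@hs_map R n F I f X) a b mX).
  exact: immersion_continuous (hs_immersion X).
have oI : open I by case: hf.
have ob := manifold_open_dom (rm_is_manifold F) b.
rewrite openE => -[t p] [/= It bp]; exists (I, chart_dom b) => //=.
by split; exact: open_nbhs_nbhs.
Qed.

Let Uimg x : U x -> chart_img a x.
Proof. by rewrite (local_domE (B := warped_atlas F I)) // => -[]. Qed.

Let Udom x : U x -> chart_dom (a := warped_atlas F I) b (hs_map (s := X) (chart_inv a x)).
Proof. by rewrite (local_domE (B := warped_atlas F I)) // => -[]. Qed.

Let psiV x : U x -> V (psi x).
Proof. by move=> /Udom bx; exists (hs_map (s := X) (chart_inv a x)). Qed.

Let psi0 x : psi x 0 o0 = tau (chart_inv a x).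
Proof. by rewrite /local_rep /= row_mxEl mxE eqxx. Qed.

Let spsi j : smooth_on U (fun x => psi x 0 j).
Proof. exact: immersion_smooth (hs_immersion X) a b j. Qed.

Let sN : smooth_field U N.
Proof. by move=> j; exact: field_along_smooth (hs_normal_field X) a b j. Qed.

Let sG := warped_smooth_metric b hf.

Let g_sym x : U x -> (g x)^T = g x.
Proof. by move=> /Uimg; exact: Defs.metric_sym (rm_is_riemannian X) a x. Qed.

Let g_pos x v : U x -> v != 0 -> 0 < inner (g x) v v.
Proof. by move=> /Uimg; exact: metric_pos (rm_is_riemannian X) a x v. Qed.

Let g_unit x : U x -> g x \in unitmx.
Proof. by move=> Ux; apply: posdef_unitmx => v; exact: g_pos. Qed.

Let sg : smooth_metric U g.
Proof.
split; [exact: oU|move=> i j|exact: g_sym|exact: g_unit].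
exact: smooth_on_sub Uimg (metric_smooth (rm_is_riemannian X) a i j).
Qed.

Let jacobian_row x i : U x -> delta_mx 0 i *m 'J psi x = dmx i psi x.
Proof.
move=> Ux; apply/rowP => j; rewrite -rowE mxE dmxE jacobianE //.
exact: (differentiable_psi oU spsi).
Qed.

Let gE x i j : U x -> g x i j = inner (G (psi x)) (dmx i psi x) (dmx j psi x).
Proof.
move=> Ux; rewrite (hs_induced (s := X) Ux) -!jacobian_row //.
by rewrite -inner_congruence inner_delta.
Qed.

Let NN x : U x -> inner (G (psi x)) (N x) (N x) = -1.
Proof. by move=> Ux; exact: hs_normal_unit (Udom Ux). Qed.

Let NE x i : U x -> inner (G (psi x)) (N x) (dmx i psi x) = 0.
Proof.
by move=> Ux; rewrite -jacobian_row //; exact: hs_normal_orthogonal Ux.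
Qed.

Let u_gt0 x : U x -> 0 < u x.
Proof. by move=> Ux; exact: hs_normal_orientation (Udom Ux). Qed.

Local Notation S := (fun x => - hs_shape (s := X) a x).

Let SE x i : U x -> cov G psi i N x = \sum_k S x i k *: dmx k psi x.
Proof.
move=> Ux; have := hs_shapeE (s := X) Ux => E.
transitivity (row i (covariant_along (@warped_metric R n F I f)
                       (@hs_normal R n F I f X) a b x)).
  apply/rowP => j; rewrite [RHS]mxE [RHS]mxE /cov mxE dmxE gamE innerE.
  congr (_ + _); apply: eq_bigr => p _; apply: eq_bigr => q _.
  rewrite chrE dmxE jacobianE //; exact: (differentiable_psi oU spsi).
rewrite -[covariant_along _ _ _ _ _]opprK -E -mulNmx row_mul mulmx_sum_row.
apply: eq_bigr => k _; rewrite mxE; congr (_ *: _).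
by rewrite rowE jacobian_row.
Qed.

Let n0 : (n%:R : R) != 0.
Proof. by rewrite pnatr_eq0 -lt0n (leq_trans _ n5). Qed.

Let trS x : U x -> \tr (S x) = n%:R * H.
Proof.
move=> /Uimg ax; rewrite -(cmc ax) /mean_curvature linearN /= mulrN mulrA mulfV //.
by rewrite mul1r.
Qed.

Let covT x i : U x ->
  cov G psi i (fun=> T) x
  = log_deriv f (psi x 0 o0) *: (dmx i psi x + inner (G (psi x)) (dmx i psi x) T *: T).
Proof.
by move=> Ux; rewrite /cov dmx_cst add0r gam_warped0 //; exact: psiV.
Qed.

Let It x : U x -> I (psi x 0 o0).
Proof. by move=> /psiV; rewrite warped_imgE => -[]. Qed.

Let ft x : U x -> 0 < f (psi x 0 o0).
Proof. by move=> /It; case: hf => _ _ _ + _; apply. Qed.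

Let dpsi0 x : U x -> differentiable (fun y => psi y 0 o0) x.
Proof. by move=> Ux; apply: differentiable_entry; exact: (differentiable_psi oU spsi). Qed.

Let dc x : U x -> derivable (log_deriv f) (psi x 0 o0) 1.
Proof. by move=> Ux; apply: (derivable_log_deriv hf); [exact: It|exact: ft]. Qed.

Let dcc x : U x -> differentiable (fun y => log_deriv f (psi y 0 o0)) x.
Proof.
move=> Ux; apply: (@differentiable_comp _ _ _ _ (fun y => psi y 0 o0) (log_deriv f)).
  exact: dpsi0.
by apply/derivable1_diffP; exact: dc.
Qed.

Let partial_cc x i : U x -> partial i (fun y => log_deriv f (psi y 0 o0)) x
  = - derive1 (log_deriv f) (psi x 0 o0) * inner (G (psi x)) (dmx i psi x) T.
Proof.
move=> Ux; rewrite (@partial_comp1 _ _ (log_deriv f) (fun y => psi y 0 o0)) //.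
- by rewrite inner_dt mulrNN dmxE.
- exact: dc.
- exact: dpsi0.
Qed.

(** Reversed Cauchy-Schwarz inequality: u^2 - 1 = |grad tau|^2 is nonnegative because the induced
    metric is Riemannian, and the orientation of [N] selects the positive sign of u. *)
Lemma angle_ge1 x : U x -> 1 <= u x.
Proof.
move=> Ux.
have := tr2_height sG sg psiV gE NN NE (T := fun=> T) (fun x _ => inner_dt_dt _ _ _ _) Ux.
have -> : metric_trace (invmx (g x)) (fun i j => inner (G (psi x)) (dmx i psi x) T
    * inner (G (psi x)) (dmx j psi x) T)
   = inner (invmx (g x)) (\row_i inner (G (psi x)) (dmx i psi x) T)
       (\row_i inner (G (psi x)) (dmx i psi x) T).
  rewrite innerE; apply: eq_bigr => i _; apply: eq_bigr => j _.
  by rewrite !mxE mulrA.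
set t := \row_i _ => E.
have : 0 <= inner (invmx (g x)) t t.
  have -> : inner (invmx (g x)) t t = inner (g x) (t *m invmx (g x)) (t *m invmx (g x)).
    by rewrite /inner trmx_mul trmx_inv g_sym // !mulmxA mulmxKV // g_unit.
  have [->|v0] := eqVneq (t *m invmx (g x)) 0; last exact/ltW/g_pos.
  by rewrite /inner !mul0mx mxE.
rewrite E; have := u_gt0 Ux; move: (u x) => v v0 v1.
by nra.
Qed.

Lemma angle_laplacian_gt0 x : U x -> 0 < laplacian g (fun y => u y) x.
Proof.
move=> Ux.
have dT y : U y -> differentiable (fun=> T : 'rV[R]_(1 + n)) y.
  by move=> _; exact: differentiable_cst.
rewrite (laplacian_angle sG sg psiV spsi sN gE NN NE SE trS (T := fun=> T)
  (fun x _ => inner_dt_dt _ _ _ _) dT (fun x i => @covT x i) dcc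
  (fun x i => @partial_cc x i) Ux).
set t := \row_i _.
have Ht : inner (invmx (g x)) t t = u x ^+ 2 - 1.
  rewrite -(tr2_height sG sg psiV gE NN NE (T := fun=> T) (fun x _ => inner_dt_dt _ _ _ _) Ux).
  rewrite innerE; apply: eq_bigr => i _; apply: eq_bigr => j _.
  by rewrite !mxE mulrA.
have n0' : (0 < n)%N by apply: leq_trans n5.
have sS : (S x *m g x)^T = S x *m g x.
  apply/matrixP => i j; rewrite mxE [LHS]mxE [RHS]mxE.
  rewrite -(second_formE gE SE j i Ux) -(second_formE gE SE i j Ux).
  exact: (second_form_sym sG sg psiV spsi sN NE j i Ux).
have bd := weingarten_bound t (log_deriv f (psi x 0 o0) / u x) (g_sym Ux)
  (fun v => g_pos Ux) (g_unit Ux) sS.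
rewrite trS // Ht in bd.
have u1 := angle_ge1 Ux.
have bH := bound (chart_inv a x).
rewrite -psi0 -expr_div_n -/(log_deriv f (psi x 0 o0)) in bH.
apply: (angle_laplacian_bound _ u1 _ bH _ _ _ bd).
- by rewrite ler_nat.
(* At a point with f' = 0 the curvature bound would give H^2 <= 0. *)
- apply: contra H0 => /eqP c0; move: bH; rewrite c0 expr0n /= mulr0.
  by rewrite -sqrf_eq0 eq_le sqr_ge0 andbT.
- exact: (ricci_normal_ge0 hf hTCC n0' (psiV Ux) (NN Ux) u1).
- exact: (warping_concave hf hTCC n0' (psiV Ux)).
- by rewrite -(derive1_log_deriv hf (It Ux) (ft Ux)) addrK.
Qed.

(** By [inner_dt] the angle function is minus the time component of [N]. *)
Lemma angle_smooth : smooth_on U (fun y => u y).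
Proof.
move=> k; apply: eq_Ck (CkM oU (Ck_cst oU k (-1)) (sN o0 k)) => // y _.
by rewrite inner_dt mulN1r.
Qed.

Lemma affine_angle_Ck (K : R) (w : X -> R) k :
  (forall y, U y -> w (chart_inv a y) = K - u y) -> Ck k U (w \o chart_inv a).
Proof.
move=> wE; apply: eq_Ck (CkD oU (Ck_cst oU k K)
  (CkM oU (Ck_cst oU k (-1)) (angle_smooth k))) => // y Uy.
by rewrite /= wE // mulN1r.
Qed.

Lemma affine_angle_laplacian (K : R) (w : X -> R) x :
  (forall y, U y -> w (chart_inv a y) = K - u y) -> U x ->
  laplacian g (w \o chart_inv a) x < 0.
Proof.
move=> wE Ux; rewrite (laplacian_affine g oU angle_smooth wE Ux) oppr_lt0.
exact: angle_laplacian_gt0.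
Qed.

End hypersurface_local.

Lemma cosh_le_expR (R : realType) (x : R) : 0 <= x -> cosh x <= expR x.
Proof.
move=> x0; rewrite /cosh ler_pdivrMr // mulr_natr mulr2n lerD2l ler_expR.
by lra.
Qed.

Theorem theorem6 (R : realType) (n : nat) (F : riemannianManifold R n)
    (I : set R) (f : R -> R)
    (hn : (5 < n + 1)%N)
    (hF : connected [set: F])
    (hf : is_warping I f)
    (hTCC : timelike_convergence F I f) :
  ~ exists (X : spacelikeHypersurface F I f) (H : R),
      complete X /\ parabolic X /\
      constant_mean_curvature X H /\ H <> 0 /\
      (forall p : X,
         H ^+ 2 <= 4 / n%:R * (derive1 f (tau p) ^+ 2 / f (tau p) ^+ 2)) /\
      bounded_hyperbolic_angle X.
Proof.
move=> [X [H [_ [[ncX pX] [cmc [/eqP H0 [bound [phi [hphi [C phiC]]]]]]]]]].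
have n5 : (5 <= n)%N by move: hn; rewrite addn1 ltnS.
(* [K] makes [w] positive: cosh(phi) <= exp(phi) <= exp(C) < K. *)
pose K := expR C + 1; pose w p := K - cosh (phi p).
(* [w] is a global function, defined through [phi]; in every pair of charts it is [K] minus the
   local expression of the angle, to which the local lemmas apply. *)
have wE (a : chart_index (rm_atlas X)) (b : chart_index (rm_atlas F)) y :
    local_dom (B := warped_atlas F I) (@hs_map R n F I f X) a b y ->
    w (chart_inv a y)
    = K - inner (@warped_metric R n F I f b
                   (local_rep (B := warped_atlas F I) (@hs_map R n F I f X) a b y))
                (hs_normal (chart_inv a y) b) (dt_field R n).
  rewrite (@local_domE _ _ _ _ _ _ (warped_atlas F I) _ _ _ (rm_is_manifold X)) => -[_ by_].
  by have [_ E] := hphi _ _ by_; rewrite /w E.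
have cover (a : chart_index (rm_atlas X)) x : chart_img a x ->
    exists b : chart_index (rm_atlas F),
    local_dom (B := warped_atlas F I) (@hs_map R n F I f X) a b x.
  move=> ax; have [b bx] := immersion_range (hs_immersion X) (chart_inv a x).
  exists b.
  by rewrite (@local_domE _ _ _ _ _ _ (warped_atlas F I) _ _ _ (rm_is_manifold X)).
have lap (a : chart_index (rm_atlas X)) x : chart_img a x ->
    laplacian (@rm_metric R n X a) (w \o chart_inv a) x < 0.
  move=> ax; have [b Ux] := cover a x ax.
  exact: (affine_angle_laplacian hf hTCC n5 cmc H0 bound (wE a b) Ux).
have w_const : forall p q, w p = w q.
  apply: pX => [p|a].
    have [b bp] := immersion_range (hs_immersion X) p.
    have [phi0 _] := hphi p b bp.
    rewrite /w /K subr_gt0; apply: le_lt_trans (cosh_le_expR phi0) _.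
    by apply: (@le_lt_trans _ _ (expR C)); [rewrite ler_expR|rewrite ltrDl].
  split=> [|x ax]; last exact/ltW/lap.
  apply: Ck_local => x ax; have [b Ux] := cover a x ax.
  exists (local_dom (B := warped_atlas F I) (@hs_map R n F I f X) a b); split=> //.
  exact: (affine_angle_Ck hf _ (wE a b)).
(* The hypersurface has a point because the empty space is compact, whereas parabolicity includes
   non-compactness. *)
have [p _] : [set: X] !=set0.
  by apply/set0P/negP => /eqP E; apply: ncX; rewrite E; exact: compact0.
have [a ap] := manifold_cover (rm_is_manifold X) p.
(* The contradiction: the Laplacian of the constant [w p] is zero, yet strictly negative by
   [lap]. *)
have := lap a (chart_map a p) (imageP _ ap).
rewrite (_ : w \o chart_inv a = fun=> w p); last by apply/funext => x; exact: w_const.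
by rewrite laplacian_cst ltxx.
Qed.
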